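(* Let $G$ be a finite group. Let $\mathfrak{L}$ and $\mathfrak{L}'$ be $\lambda$-graph systems over finite alphabets $\Sigma$ and $\Sigma'$, with associated symbolic matrix systems $(\mathcal{M},I)$ and $(\mathcal{M}',I')$, respectively. Let $\ell:\Sigma\to G$ and $\ell':\Sigma'\to G$ be maps, and let $(\mathcal{M}^{\ell},I)$ and $(\mathcal{M}'^{\ell'},I')$ be the resulting symbolic matrix systems over $\mathbb{Z}_+G$. Let $\tau_\ell:\Lambda_{\mathfrak{L}}\to G$, $\tau_\ell((x_n)_n)=\ell(x_0)$, and $\tau_{\ell'}:\Lambda_{\mathfrak{L}'}\to G$, $\tau_{\ell'}((y_n)_n)=\ell'(y_0)$. Consider the conditions: (1) $(\mathcal{M}^{\ell},I)$ and $(\mathcal{M}'^{\ell'},I')$ are properly $G$-strong shift equivalent. (2) There exists a topological conjugacy $\Phi:\Lambda_{\mathfrak{L}}\to\Lambda_{\mathfrak{L}'}$ such that $\tau_\ell$ is cohomologous to $\tau_{\ell'}\circ\Phi$ in $C(\Lambda_{\mathfrak{L}},G)$. (3) The $G$-subshifts $\Lambda_{\mathfrak{L}^{G,\ell}}$ and $\Lambda_{\mathfrak{L}'^{G,\ell'}}$ are $G$-conjugate. Then $(1)\Rightarrow(2)\Leftrightarrow(3)$. If, in particular, $\mathfrak{L}$ and $\mathfrak{L}'$ are both canonical $\lambda$-graph systems (that is, $\mathfrak{L}=\mathfrak{L}^{\Lambda}$ and $\mathfrak{L}'=\mathfrak{L}^{\Lambda'}$ for the subshifts $\Lambda=\Lambda_{\mathfrak{L}}$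 and $\Lambda'=\Lambda_{\mathfrak{L}'}$), then also $(2)\Rightarrow(1)$.
   Context: Subshifts: a subshift over a finite alphabet $\Sigma$ is a closed shift-invariant subset of $\Sigma^{\mathbb{Z}}$ with the shift $\sigma((x_i)_i)=(x_{i+1})_i$. $B_l(\Lambda)$ is the set of words of length $l$ appearing in $\Lambda$, and $\Lambda^+=\{(x_n)_{n\in\mathbb{N}}:(x_n)_{n\in\mathbb{Z}}\in\Lambda\}$, $\mathbb{N}=\{1,2,\dots\}$. A $G$-subshift is a subshift with an action of $G$ by homeomorphisms commuting with the shift; $G$-conjugate means topologically conjugate by a conjugacy commuting with the $G$-actions. Functions $\tau,\tau'\in C(\Lambda,G)$ (continuous $G$-valued functions) are cohomologous if there is $\gamma\in C(\Lambda,G)$ with $\tau(x)=\gamma(x)\tau'(x)\gamma(\sigma(x))^{-1}$ for all $x\in\Lambda$. $\lambda$-graph systems: a $\lambda$-graph system $\mathfrak{L}=(V,E,\lambda,\iota)$ over $\Sigma$ consists of a vertex set $V=\bigsqcup_{l\ge 0}V_l$ and an edge set $E=\bigsqcup_{l\ge 0}E_{l,l+1}$ with all $V_l,E_{l,l+1}$ finite, source and terminal maps $s:E_{l,l+1}\to V_l$, $t:E_{l,l+1}\to V_{l+1}$, a labeling map $\lambda:E\to\Sigma$ and surjections $\iota=\iota_{l,l+1}:V_{l+1}\to V_l$, such that: every vertex is the source of some edge; every vertex in $V_l$, $l\ge1$, is the terminal of some edge; for $l\ge 1$ and $v\in V_{l+1}$, there is an edge in $E_{l,l+1}$ labeled $\alpha$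 with terminal $v$ if and only if there is an edge in $E_{l-1,l}$ labeled $\alpha$ with terminal $\iota(v)$; and (local property) for $l\ge1$, $u\in V_{l-1}$, $v\in V_{l+1}$ there is a label-preserving bijection between $\{e\in E_{l,l+1}: t(e)=v,\ \iota(s(e))=u\}$ and $\{e\in E_{l-1,l}: s(e)=u,\ t(e)=\iota(v)\}$. All $\lambda$-graph systems are assumed left-resolving: $t(e)\ne t(f)$ whenever $e\neq f$ and $\lambda(e)=\lambda(f)$. The subshift $\Lambda_{\mathfrak{L}}$ presented by $\mathfrak{L}$ is the subshift whose admissible words are exactly the label words of finite paths in $\mathfrak{L}$. Canonical $\lambda$-graph system of a subshift $\Lambda$: for $x\in\Lambda^+$ and $l\geq 0$ put $\Gamma_l^-(x)=\{(\mu_1,\dots,\mu_l)\in B_l(\Lambda):(\mu_1,\dots,\mu_l,x_1,x_2,\dots)\in\Lambda^+\}$; $x\sim_l y$ ($l$-past equivalent) if $\Gamma_l^-(x)=\Gamma_l^-(y)$. The vertices of $\mathfrak{L}^\Lambda$ at level $l$ are the $\sim_l$-classes $F^l_i$ of $\Lambda^+$; there is an edge labeled $\alpha$ from $F_i^l$ to $F_j^{l+1}$ if $\alpha x\in F_i^l$ for some $x\in F_j^{l+1}$; and $\iota(F^{l+1}_j)=F_i^l$ if $F^{l+1}_j\subset F^l_i$. Extension: $\mathfrak{L}^{G,\ell}=(V^G,E^G,\lambda^G,\iota^G)$ is the $\lambda$-graph system over $G\times\Sigma$ with $V^G_l=G\times V_l$, $E^G_{l,l+1}=G\times E_{l,l+1}$,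 $\iota^G(g,v)=(g,\iota(v))$, $s(g,e)=(g,s(e))$, $t(g,e)=(g\,\ell(\lambda(e)),t(e))$, $\lambda^G(g,e)=(g,\lambda(e))$. The subshift $\Lambda_{\mathfrak{L}^{G,\ell}}$ is a $G$-subshift with the action $\rho_g((g_n,x_n)_n)=(g g_n,x_n)_n$. Symbolic matrix systems: $\mathfrak{S}_\Sigma$ is the set of finite formal sums of elements of $\Sigma$ (including the empty sum $0$). A symbolic matrix system $(\mathcal{M},I)$ over $\Sigma$ is a sequence of pairs of $m(l)\times m(l+1)$ matrices $(\mathcal{M}_{l,l+1},I_{l,l+1})$, $l\ge0$, $\mathcal{M}_{l,l+1}$ with entries in $\mathfrak{S}_\Sigma$, $I_{l,l+1}$ with entries in $\{0,1\}$, none having a zero row or zero column, each column of $I_{l,l+1}$ having exactly one $1$, with $I_{l,l+1}\mathcal{M}_{l+1,l+2}=\mathcal{M}_{l,l+1}I_{l+1,l+2}$. The one associated with $\mathfrak{L}$, where $V_l=\{v^l_1,\dots,v^l_{m(l)}\}$, has $\mathcal{M}_{l,l+1}(i,j)$ equal to the formal sum of labels of edges from $v_i^l$ to $v_j^{l+1}$, and $I_{l,l+1}(i,j)=1$ iff $\iota(v^{l+1}_j)=v^l_i$. Given $\ell:\Sigma\to G$, $\mathcal{M}^\ell_{l,l+1}$ is the matrix over the semigroup ring $\mathbb{Z}_+G$ obtained by replacing each symbol $\alpha$ by $\ell(\alpha)$; $(\mathcal{M}^\ell,I)$ is the resulting symbolic matrix system over $\mathbb{Z}_+G$ (the data $(\mathcal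 M,I)$ and $\ell$ are retained). Products: for alphabets $C,D$, $C\cdot D=\{cd:c\in C,d\in D\}$ (formal pairs), and $(\sum_jc_j)(\sum_kd_k)=\sum_{j,k}c_jd_k$. A specification is an injective relabeling map between alphabets, and $\overset{\varphi}{\simeq}$ means entrywise equality after relabeling by the specification $\varphi$. Proper strong shift equivalence in 1-step, $(\mathcal{M},I)\approx_{1\text{-}pr}(\mathcal{M}',I')$: there are alphabets $C,D$, specifications $\varphi:\Sigma\to C\cdot D$, $\phi:\Sigma'\to D\cdot C$, nondecreasing sequences $n(l),n'(l)$ (with $n(2l)=m(l)$, $n'(2l)=m'(l)$), and for each $l\ge0$ an $n(l)\times n'(l+1)$ matrix $\mathcal{P}_l$ over $C$, an $n'(l)\times n(l+1)$ matrix $\mathcal{Q}_l$ over $D$ (entries in $\mathfrak{S}_C$, $\mathfrak{S}_D$), an $n(l)\times n(l+1)$ matrix $X_l$ and an $n'(l)\times n'(l+1)$ matrix $X'_l$ over $\{0,1\}$ with $\mathcal{M}_{l,l+1}\overset{\varphi}{\simeq}\mathcal{P}_{2l}\mathcal{Q}_{2l+1}$, $\mathcal{M}'_{l,l+1}\overset{\phi}{\simeq}\mathcal{Q}_{2l}\mathcal{P}_{2l+1}$, $I_{l,l+1}=X_{2l}X_{2l+1}$, $I'_{l,l+1}=X'_{2l}X'_{2l+1}$, $X_l\mathcal{P}_{l+1}=\mathcal{P}_lX'_{l+1}$, $X'_l\mathcal{Q}_{l+1}=\mathcal{Q}_lX_{l+1}$. Proper $G$-strong shift equivalence: $(\mathcal{M}^\ell,I)$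 and $(\mathcal{M}'^{\ell'},I')$ are properly $G$-strong shift equivalent in 1-step if $(\mathcal{M},I)\approx_{1\text{-}pr}(\mathcal{M}',I')$ via some alphabets $C,D$, specifications $\varphi:\Sigma\to C\cdot D$ and $\phi:\Sigma'\to D\cdot C$, nondecreasing sequences $n(l),n'(l)$ with $n(2l)=m(l)$, $n'(2l)=m'(l)$, and matrices $\mathcal{P}_l$ over $C$ (of size $n(l)\times n'(l+1)$), $\mathcal{Q}_l$ over $D$ (of size $n'(l)\times n(l+1)$), and $X_l$, $X'_l$ over $\{0,1\}$ (of sizes $n(l)\times n(l+1)$ and $n'(l)\times n'(l+1)$), $l\ge0$, satisfying $\mathcal{M}_{l,l+1}\overset{\varphi}{\simeq}\mathcal{P}_{2l}\mathcal{Q}_{2l+1}$, $\mathcal{M}'_{l,l+1}\overset{\phi}{\simeq}\mathcal{Q}_{2l}\mathcal{P}_{2l+1}$, $I_{l,l+1}=X_{2l}X_{2l+1}$, $I'_{l,l+1}=X'_{2l}X'_{2l+1}$, $X_l\mathcal{P}_{l+1}=\mathcal{P}_lX'_{l+1}$, $X'_l\mathcal{Q}_{l+1}=\mathcal{Q}_lX_{l+1}$, and there are maps $\ell_C:C\to G$, $\ell_D:D\to G$ such that, with $\ell_{CD}(cd)=\ell_C(c)\ell_D(d)$ and $\ell_{DC}(dc)=\ell_D(d)\ell_C(c)$, one has $\ell=\ell_{CD}\circ\varphi$, $\ell'=\ell_{DC}\circ\phi$, and $\mathcal{M}^\ell_{l,l+1}=\mathcal{P}^{\ell_C}_{2l}\mathcal{Q}^{\ell_D}_{2l+1}$,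 $\mathcal{M}'^{\ell'}_{l,l+1}=\mathcal{Q}^{\ell_D}_{2l}\mathcal{P}^{\ell_C}_{2l+1}$ for all $l\ge0$. They are properly $G$-strong shift equivalent if they are connected by a finite chain of proper $G$-strong shift equivalences in 1-step (through symbolic matrix systems over $\mathbb{Z}_+G$ arising from symbolic matrix systems over alphabets $\Sigma_k$ with maps $\ell_k:\Sigma_k\to G$). *)

(* Defs.v *)
From Stdlib Require Import Relation_Operators.
From HB Require Import structures.
From mathcomp Require Import all_boot all_order all_algebra all_fingroup.
From mathcomp Require Import boolp classical_sets functions topology.
From mathcomp Require Import zify.

Set Implicit Arguments.
Unset Strict Implicit.
Unset Printing Implicit Defensive.

Import GRing.Theory.
Local Open Scope classical_set_scope.

Definition full_shift (Sigma : finType) : topologicalType :=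
  {ptws int -> discrete_topology Sigma}.

Definition shift (Sigma : finType) (x : full_shift Sigma) : full_shift Sigma :=
  fun i => x (i + 1)%R.

Record subshift (Sigma : finType) := Subshift {
  points :> set (full_shift Sigma);
  points_closed : closed points;
  points_shift : @shift Sigma @` points = points }.

Lemma shift_in (Sigma : finType) (X : subshift Sigma) (x : X) :
  shift (val x) \in (X : set (full_shift Sigma)).
Proof.
apply/mem_set.
suff: (@shift Sigma @` X) (shift (val x)) by rewrite points_shift.
by exists (val x) => //; exact/set_mem/valP.
Qed.

Definition shift_on (Sigma : finType) (X : subshift Sigma) (x : X) : X :=
  SigSub (shift_in x).

Definition word_at (Sigma : finType) (x : full_shift Sigma) (i : int) (n : nat)
  : n.-tuple Sigma := [tuple x (i + k%:Z)%R | k < n].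

Definition admissible (Sigma : finType) (X : set (full_shift Sigma)) (n : nat)
  : set (n.-tuple Sigma) :=
  [set w | exists x, X x /\ exists i, word_at x i n = w].

Definition homeomorphism (X Y : topologicalType) (f : X -> Y) : Prop :=
  continuous f /\ exists g : Y -> X, [/\ cancel f g, cancel g f & continuous g].

Definition conjugacy (Sigma Sigma' : finType) (X : subshift Sigma)
    (Y : subshift Sigma') (Phi : X -> Y) : Prop :=
  homeomorphism Phi /\ forall x, Phi (shift_on x) = shift_on (Phi x).

(* Continuity of the inverse of [gact g] follows from [gact1] and [gactM]. *)
Record gsubshift (G : finGroupType) (Sigma : finType) := GSubshift {
  gpoints :> subshift Sigma;
  gact : G -> gpoints -> gpoints;
  gact1 : forall x, gact 1%g x = x;
  gactM : forall g h x, gact (g * h)%g x = gact g (gact h x);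
  gact_continuous : forall g, continuous (gact g);
  gact_shift : forall g x, gact g (shift_on x) = shift_on (gact g x) }.

Definition gconjugate (G : finGroupType) (Sigma Sigma' : finType)
    (X : gsubshift G Sigma) (Y : gsubshift G Sigma') : Prop :=
  exists Phi : X -> Y,
    conjugacy Phi /\ forall g x, Phi (gact g x) = gact g (Phi x).

Definition cohomologous (G : finGroupType) (Sigma : finType)
    (X : subshift Sigma) (tau tau' : X -> G) : Prop :=
  exists gamma : X -> discrete_topology G, continuous gamma /\
    forall x, tau x =
      ((gamma x : G) * tau' x * (gamma (shift_on x) : G)^-1)%g.

Definition tau (G : finGroupType) (Sigma : finType) (X : subshift Sigma)
  (ell : Sigma -> G) (x : X) : G := ell (val x 0%R).

Lemma tau_continuous (G : finGroupType) (Sigma : finType) (X : subshift Sigma)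
  (ell : Sigma -> G) : continuous (tau ell : X -> discrete_topology G).
Proof.
move=> x U /nbhs_singleton Ux.
have cont : continuous (fun y : X => val y 0%R : discrete_topology Sigma).
  move=> y; apply: (continuous_comp
      (f := val : X -> full_shift Sigma)
      (g := fun z => z 0%R : discrete_topology Sigma)).
    exact: initial_continuous.
  exact: (@proj_continuous _ (fun=> discrete_topology Sigma)).
have H := cont x [set val x 0%R] (discrete_set1 _).
apply: (@filterS _ (nbhs x) _ _ _ _ H) => y /= yx.
by move: Ux; rewrite /= /tau -[val x 0%R]yx.
Qed.

(* [edge l] is the set of edges from [vertex l] to [vertex l.+1]. *)
Record lambda_graph (Sigma : finType) := LambdaGraph {
  vertex : nat -> finType;
  edge : nat -> finType;
  src : forall l, edge l -> vertex l;
  tgt : forall l, edge l -> vertex l.+1;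
  lab : forall l, edge l -> Sigma;
  iota : forall l, vertex l.+1 -> vertex l;
  iota_surj : forall l (v : vertex l), exists u : vertex l.+1, iota u = v;
  has_out : forall l (v : vertex l), exists e : edge l, src e = v;
  has_in : forall l (v : vertex l.+1), exists e : edge l, tgt e = v;
  iota_in : forall l (v : vertex l.+2) (a : Sigma),
    (exists e : edge l.+1, lab e = a /\ tgt e = v) <->
    (exists e : edge l, lab e = a /\ tgt e = iota v);
  local_property : forall l (u : vertex l) (v : vertex l.+2),
    exists f : {e : edge l.+1 | (tgt e == v) && (iota (src e) == u)} ->
               {e : edge l | (src e == u) && (tgt e == iota v)},
      bijective f /\ forall e, lab (val (f e)) = lab (val e);
  left_resolving : forall l (e f : edge l), e <> f -> lab e = lab f ->
    tgt e <> tgt f }.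

Arguments vertex {Sigma} _ _.
Arguments edge {Sigma} _ _.

(* [reads w v]: [w] is the label word of a finite path starting at [v]. *)
Fixpoint reads (Sigma : finType) (L : lambda_graph Sigma) (w : seq Sigma) :
    forall l, vertex L l -> Prop :=
  if w is a :: w' then
    fun l v => exists e : edge L l, [/\ src e = v, lab e = a & reads w' (tgt e)]
  else fun _ _ => True.

Definition label_word (Sigma : finType) (L : lambda_graph Sigma)
  (w : seq Sigma) : Prop := exists l (v : vertex L l), reads w v.

Definition presented_points (Sigma : finType) (L : lambda_graph Sigma) :
  set (full_shift Sigma) := [set x | forall i n, label_word L (word_at x i n)].

Lemma presented_closed (Sigma : finType) (L : lambda_graph Sigma) :
  closed (presented_points L).
Proof.
move=> x clx i n.
have [y [Py yx]] : presented_points L `&`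
    [set y | forall k : 'I_n, y (i + k%:Z)%R = x (i + k%:Z)%R] !=set0.
  apply: clx.
  have := @filter_forall (full_shift Sigma) 'I_n
    (fun k => [set y : full_shift Sigma | y (i + k%:Z)%R = x (i + k%:Z)%R])
    (nbhs x) _.
  apply => k.
  have := @proj_continuous _ (fun=> discrete_topology Sigma) (i + k%:Z)%R x.
  by move=> /(_ [set x (i + k%:Z)%R]); apply; exact: discrete_set1.
suff <- : word_at y i n = word_at x i n by exact: Py.
by apply: eq_from_tnth => k; rewrite !tnth_mktuple yx.
Qed.

Lemma word_at_shift (Sigma : finType) (x : full_shift Sigma) i n :
  word_at (shift x) i n = word_at x (i + 1)%R n.
Proof.
by apply: eq_from_tnth => k; rewrite !tnth_mktuple /shift addrAC.
Qed.

Lemma presented_shift (Sigma : finType) (L : lambda_graph Sigma) :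
  @shift Sigma @` presented_points L = presented_points L.
Proof.
apply/seteqP; split=> [_ [x Px <-] i n|x Px]; first by rewrite word_at_shift.
have xE : shift (fun i => x (i - 1)%R) = x.
  by apply/funext => i; rewrite /shift addrK.
by exists (fun i => x (i - 1)%R) => // i n; rewrite -(subrK 1%R i)
  -word_at_shift xE.
Qed.

Definition presented (Sigma : finType) (L : lambda_graph Sigma) :
  subshift Sigma := Subshift (@presented_closed _ L) (@presented_shift _ L).

Lemma reads_lift (Sigma : finType) (L : lambda_graph Sigma) (w : seq Sigma)
    l (v : vertex L l) : reads w v -> exists u : vertex L l.+1, iota u = v /\ reads w u.
Proof.
elim: w l v => [|a w IH] l v /=.
  by have [u uv] := iota_surj v; exists u.
move=> [e [se le /IH [u [ue ru]]]].
have [f [[f' _ f'K] flab]] := local_property v u.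
have Pe : (src e == v) && (tgt e == iota u) by rewrite se ue !eqxx.
pose e' := f' (exist _ e Pe).
have /andP[/eqP te' /eqP ie'] := valP e'.
exists (src (val e')); split=> //; exists (val e').
by split=> //; rewrite ?te' // -flab f'K.
Qed.

Lemma reads_rcons (Sigma : finType) (L : lambda_graph Sigma) (w : seq Sigma)
  l (v : vertex L l) : reads w v -> exists b, reads (rcons w b) v.
Proof.
elim: w l v => [|a w IH] l v /=.
  by move=> _; have [e se] := has_out v; exists (lab e), e.
by move=> [e [se le /IH[b rb]]]; exists b, e.
Qed.

Lemma label_word_extend (Sigma : finType) (L : lambda_graph Sigma) w :
  label_word L w -> exists ab, label_word L (ab.1 :: rcons w ab.2).
Proof.
move=> [l [v /reads_rcons[b /reads_lift[u [_ ru]]]]].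
have [e eu] := has_in u; exists (lab e, b), l, (src e), e.
by split=> //; rewrite eu.
Qed.

Lemma label_word_catl (Sigma : finType) (L : lambda_graph Sigma) w1 w2 :
  label_word L (w1 ++ w2) -> label_word L w1.
Proof.
move=> [l [v rv]]; exists l, v; elim: w1 l v rv => //= a w IH l v.
by move=> [e [se le /IH re]]; exists e.
Qed.

Lemma label_word_catr (Sigma : finType) (L : lambda_graph Sigma) w1 w2 :
  label_word L (w1 ++ w2) -> label_word L w2.
Proof.
move=> [l [v rv]]; elim: w1 l v rv => [|a w IH] l v /=; first by exists l, v.
by move=> [e [_ _ /IH]].
Qed.

(* The admissible words of [presented L] are exactly the label words of [L]. *)
Lemma admissible_presented (Sigma : finType) (L : lambda_graph Sigma) n
  (w : n.-tuple Sigma) : admissible (presented L) w <-> label_word L w.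
Proof.
split=> [[x [Px [i <-]]]|Lw]; first exact: Px.
have [[d _] _] := label_word_extend Lw.
have H (u : seq Sigma) : exists ab, label_word L u ->
    label_word L (ab.1 :: rcons u ab.2).
  have [/label_word_extend[ab Hab]|nLu] := pselect (label_word L u).
    by exists ab.
  by exists (d, d).
have {H}[f fP] := choice H.
pose W m := iter m (fun u => (f u).1 :: rcons u (f u).2) (w : seq Sigma).
have LW m : label_word L (W m) by elim: m => //= m /fP.
have sW m : size (W m) = (n + m.*2)%N.
  elim: m => [|m IH] /=; first by rewrite size_tuple addn0.
  by rewrite size_rcons IH doubleS !addnS.
have nthW m p k : (k < n + m.*2)%N -> nth d (W (p + m)%N) (p + k) = nth d (W m) k.
  move=> lk; elim: p => [|p IH] //=.
  by rewrite nth_rcons sW IH ifT //; lia.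
pose x : full_shift Sigma := fun j => nth d (W `|j|%N.+1) `|(`|j|%N.+1%:Z + j)%R|%N.
have xW (j : int) m : (0 <= m%:Z + j)%R -> (j < (n + m)%N%:Z)%R ->
    x j = nth d (W m) `|(m%:Z + j)%R|%N.
  move=> jm jn; rewrite /x; set m0 := `|j|%N.+1.
  have [le|lt] := leqP m0 m.
    rewrite -[in RHS](subnK le) -(nthW _ (m - m0)%N); last by lia.
    by congr (nth _ _ _); lia.
  rewrite -[in LHS](subnK (ltnW lt)) -(nthW m (m0 - m)%N); last by lia.
  by congr (nth _ _ _); lia.
exists x; split.
  move=> i n'; pose m := (`|i| + n')%N; pose a := `|(m%:Z + i)%R|%N.
  have la : (a + n' <= n + m.*2)%N by rewrite /a /m; lia.
  have : label_word L (take n' (drop a (W m))).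
    apply: (@label_word_catl _ _ _ (drop n' (drop a (W m)))).
    rewrite cat_take_drop; apply: (@label_word_catr _ _ (take a (W m))).
    by rewrite cat_take_drop.
  suff -> : take n' (drop a (W m)) = word_at x i n' by [].
  apply: (@eq_from_nth _ d) => [|k].
    by rewrite size_takel ?size_drop ?sW; [rewrite size_tuple|lia].
  rewrite size_takel ?size_drop ?sW; last by lia.
  move=> lk; rewrite nth_take // nth_drop.
  rewrite -[k]/(nat_of_ord (Ordinal lk)) -tnth_nth tnth_mktuple /=.
  by rewrite (@xW _ m) ?/a /m; [congr (nth _ _ _); lia | lia | lia].
exists 0%R; apply: eq_from_tnth => k; rewrite tnth_mktuple.
rewrite (@xW _ 0%N); try by move: (ltn_ord k); lia.
by rewrite (tnth_nth d); congr (nth _ _ _); lia.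
Qed.

(* Right-infinite sequences are indexed from 0: entry [k] is [x_(k+1)]. *)
Definition right_part (Sigma : finType) (x : full_shift Sigma) : nat -> Sigma :=
  fun k => x (k.+1%:Z)%R.

Definition right_points (Sigma : finType) (X : set (full_shift Sigma)) :
  set (nat -> Sigma) := @right_part Sigma @` X.

Definition prepend (Sigma : Type) (w : seq Sigma) (x : nat -> Sigma) :
  nat -> Sigma := fun k => nth (x (k - size w)%N) w k.

Definition past (Sigma : finType) (X : set (full_shift Sigma)) (l : nat)
    (x : nat -> Sigma) : set (l.-tuple Sigma) :=
  [set w | admissible X w /\ right_points X (prepend w x)].
Arguments past {Sigma} X l x.

Definition past_class (Sigma : finType) (X : set (full_shift Sigma)) (l : nat)
    (x : nat -> Sigma) : set (nat -> Sigma) :=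
  [set y | right_points X y /\ past X l y = past X l x].

(* [L] is the canonical lambda-graph system of [X], up to the naming of vertices
   and edges: [F l] identifies [vertex L l] with the set of l-past equivalence
   classes. Parallel edges with equal labels are excluded by [left_resolving]. *)
Definition canonical_of (Sigma : finType) (L : lambda_graph Sigma)
    (X : set (full_shift Sigma)) : Prop :=
  exists F : forall l, vertex L l -> set (nat -> Sigma),
    [/\ forall l, injective (F l),
        forall l, range (F l) = past_class X l @` right_points X,
        forall l (u : vertex L l) (v : vertex L l.+1) (a : Sigma),
          (exists e : edge L l, [/\ src e = u, tgt e = v & lab e = a]) <->
          (exists2 x, F l.+1 v x & F l u (prepend [:: a] x)) &
        forall l (u : vertex L l) (v : vertex L l.+1),
          iota v = u <-> F l.+1 v `<=` F l u].

Definition canonical_system (Sigma : finType) (L : lambda_graph Sigma) : Prop :=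
  canonical_of L (presented L).

Lemma pair_eq (A B : Type) (a a' : A) (b b' : B) :
  a = a' -> b = b' -> (a, b) = (a', b').
Proof. by move=> -> ->. Qed.

Section Extension.
Variables (G : finGroupType) (Sigma : finType) (L : lambda_graph Sigma).
Variable ell : Sigma -> G.

Definition ext_V l : finType := (G * vertex L l)%type.
Definition ext_E l : finType := (G * edge L l)%type.
Definition ext_src l (e : ext_E l) : ext_V l := (e.1, src e.2).
Definition ext_tgt l (e : ext_E l) : ext_V l.+1 :=
  ((e.1 * ell (lab e.2))%g, tgt e.2).
Definition ext_lab l (e : ext_E l) : (G * Sigma)%type := (e.1, lab e.2).
Definition ext_iota l (v : ext_V l.+1) : ext_V l := (v.1, iota v.2).

Lemma ext_iota_surj l (v : ext_V l) : exists u : ext_V l.+1, ext_iota u = v.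
Proof.
by case: v => g v; have [u <-] := iota_surj v; exists (g, u).
Qed.

Lemma ext_has_out l (v : ext_V l) : exists e : ext_E l, ext_src e = v.
Proof. by case: v => g v; have [e <-] := has_out v; exists (g, e). Qed.

Lemma ext_has_in l (v : ext_V l.+1) : exists e : ext_E l, ext_tgt e = v.
Proof.
case: v => g v; have [e <-] := has_in v.
by exists ((g * (ell (lab e))^-1)%g, e); rewrite /ext_tgt /= mulgKV.
Qed.

Lemma ext_iota_in l (v : ext_V l.+2) (a : G * Sigma) :
  (exists e : ext_E l.+1, ext_lab e = a /\ ext_tgt e = v) <->
  (exists e : ext_E l, ext_lab e = a /\ ext_tgt e = ext_iota v).
Proof.
case: v a => h v [g a]; split=> -[[k e]] [[-> <-] [<- te]].
  have [f [fe ft]] := (iota_in v (lab e)).1 (ex_intro _ e (conj erefl te)).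
  by exists (g, f); rewrite /ext_lab /ext_tgt /ext_iota /= fe ft.
have [f [fe ft]] := (iota_in v (lab e)).2 (ex_intro _ e (conj erefl te)).
by exists (g, f); rewrite /ext_lab /ext_tgt /= fe ft.
Qed.

Lemma ext_local_property l (u : ext_V l) (v : ext_V l.+2) :
  exists f : {e : ext_E l.+1 | (ext_tgt e == v) && (ext_iota (ext_src e) == u)} ->
             {e : ext_E l | (ext_src e == u) && (ext_tgt e == ext_iota v)},
    bijective f /\ forall e, ext_lab (val (f e)) = ext_lab (val e).
Proof.
case: u v => g u [h v].
have [f [[f' fK f'K] flab]] := local_property u v.
have H1 (e : ext_E l.+1) :
    (ext_tgt e == (h, v)) && (ext_iota (ext_src e) == (g, u)) ->
    (tgt e.2 == v) && (iota (src e.2) == u).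
  by rewrite !xpair_eqE /= => /andP[/andP[_ ->] /andP[_ ->]].
have H2 (e : {e : ext_E l.+1 | (ext_tgt e == (h, v)) && (ext_iota (ext_src e) == (g, u))}) :
    (ext_src (g, val (f (exist _ (val e).2 (H1 _ (valP e))))) == (g, u)) &&
    (ext_tgt (g, val (f (exist _ (val e).2 (H1 _ (valP e))))) == ext_iota (h, v)).
  have := valP (f (exist _ (val e).2 (H1 _ (valP e)))).
  rewrite !xpair_eqE /= flab eqxx /= => /andP[-> ->]; rewrite andbT /=.
  by case: e => -[k e] /=; rewrite !xpair_eqE /= => /andP[/andP[/eqP <- _] /andP[/eqP <- _]].
have H3 (e : ext_E l) :
    (ext_src e == (g, u)) && (ext_tgt e == ext_iota (h, v)) ->
    (src e.2 == u) && (tgt e.2 == iota v).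
  by rewrite !xpair_eqE /= => /andP[/andP[_ ->] /andP[_ ->]].
have H4 (e : {e : ext_E l | (ext_src e == (g, u)) && (ext_tgt e == ext_iota (h, v))}) :
    (ext_tgt (g, val (f' (exist _ (val e).2 (H3 _ (valP e))))) == (h, v)) &&
    (ext_iota (ext_src (g, val (f' (exist _ (val e).2 (H3 _ (valP e)))))) == (g, u)).
  have := valP (f' (exist _ (val e).2 (H3 _ (valP e)))).
  rewrite !xpair_eqE /= -flab f'K eqxx /= => /andP[-> ->]; rewrite !andbT /=.
  by case: e => -[k e] /=; rewrite !xpair_eqE /= => /andP[/andP[/eqP <- _] /andP[/eqP <- _]].
have fsK z Pz : val (f' (exist _ (val (f z)) Pz)) = val z.
  by rewrite [X in f' X](_ : _ = f z) ?fK //; exact: val_inj.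
have f'sK z Pz : val (f (exist _ (val (f' z)) Pz)) = val z.
  by rewrite [X in f X](_ : _ = f' z) ?f'K //; exact: val_inj.
exists (fun e => exist (fun e : ext_E l => (ext_src e == (g, u)) &&
  (ext_tgt e == ext_iota (h, v))) _ (H2 e)); split.
  exists (fun e => exist (fun e : ext_E l.+1 => (ext_tgt e == (h, v)) &&
    (ext_iota (ext_src e) == (g, u))) _ (H4 e)) => -[[k e] Pe]; apply: val_inj => /=;
    apply: pair_eq.
  - by move: Pe; rewrite !xpair_eqE => /andP[_ /andP[/eqP <- _]].
  - exact: fsK.
  - by move: Pe; rewrite !xpair_eqE => /andP[/andP[/eqP <- _] _].
  - exact: f'sK.
move=> [[k e] Pe]; rewrite /ext_lab /= flab /=; apply: pair_eq => //.
by move: Pe; rewrite !xpair_eqE => /andP[_ /andP[/eqP <- _]].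
Qed.

Lemma ext_left_resolving l (e f : ext_E l) :
  e <> f -> ext_lab e = ext_lab f -> ext_tgt e <> ext_tgt f.
Proof.
case: e f => g e [h f] nef [gh lef] [_ tef]; subst h.
by apply: (@left_resolving _ _ _ e f) => // ef; apply: nef; rewrite ef.
Qed.

Definition extension : lambda_graph (G * Sigma)%type :=
  LambdaGraph ext_iota_surj ext_has_out ext_has_in ext_iota_in ext_local_property
    ext_left_resolving.

Definition translate (g : G) (x : full_shift (G * Sigma)%type) :
  full_shift (G * Sigma)%type := fun i => ((g * (x i).1)%g, (x i).2).

Lemma reads_translate g w l (v : vertex extension l) : reads w v ->
  reads (L := extension) [seq ((g * a.1)%g, a.2) | a <- w]
    ((g * v.1)%g, v.2).
Proof.
elim: w l v => //= a w IH l v [[k e]] [<- <- /IH /= re].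
by exists ((g * k)%g, e); split=> //=; rewrite /ext_tgt /= -mulgA.
Qed.

Lemma translate_in g (x : presented extension) :
  translate g (val x) \in (presented extension : set (full_shift _)).
Proof.
apply/mem_set => i n.
have [l [v /(reads_translate g) rv]] := set_mem (valP x) i n.
exists l, ((g * v.1)%g, v.2).
suff -> : word_at (translate g (val x)) i n =
  [seq ((g * a.1)%g, a.2) | a <- word_at (val x) i n] :> seq _ by [].
by rewrite /word_at /= -[RHS]map_comp.
Qed.

Definition translate_on g (x : presented extension) : presented extension :=
  SigSub (translate_in g x).

Lemma translate_on1 x : translate_on 1%g x = x.
Proof.
apply: val_inj; apply/funext => i /=; rewrite /translate mul1g.
by case: (val x i).
Qed.

Lemma translate_onM g h x :
  translate_on (g * h)%g x = translate_on g (translate_on h x).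
Proof. by apply: val_inj; apply/funext => i /=; rewrite /translate mulgA. Qed.

Lemma translate_continuous g : continuous (translate g).
Proof.
move=> x.
have FF : Filter (translate g @ nbhs x) by exact: fmap_filter.
apply/cvg_sup => i U [_ [[W oW <-] Wx WU]].
have H := @proj_continuous _ (fun=> discrete_topology (G * Sigma)%type) i x
  [set x i] (discrete_set1 _).
apply: (@filterS _ (nbhs x) _ _ _ _ H) => y /= yx; apply: WU.
by move: Wx; rewrite /= /translate -[x i]yx.
Qed.

Lemma translate_on_continuous g : continuous (translate_on g).
Proof.
apply: continuous_comp_initial => x.
apply: (continuous_comp _ (@translate_continuous g _)).
exact: initial_continuous.
Qed.

Lemma translate_on_shift g x :
  translate_on g (shift_on x) = shift_on (translate_on g x).
Proof. exact: val_inj. Qed.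

Definition extension_gsubshift : gsubshift G (G * Sigma)%type :=
  GSubshift translate_on1 translate_onM translate_on_continuous
    translate_on_shift.

End Extension.

(* A finite formal sum of symbols, given by the multiplicity of each symbol. *)
Notation formal_sum S := {ffun S -> nat}.

Definition symbol (S : finType) (a : S) : formal_sum S :=
  [ffun b => (b == a : nat)].

Definition substitute (S T : finType) (f : S -> T) (a : formal_sum S) :
  formal_sum T := [ffun t => \sum_(s | f s == t) a s]%N.

Definition pair_mul (C D : finType) (a : formal_sum C) (b : formal_sum D) :
  formal_sum (C * D)%type := [ffun p => a p.1 * b p.2]%N.

Definition symbolic_mul (m n p : nat) (C D : finType)
    (P : 'M[formal_sum C]_(m, n)) (Q : 'M[formal_sum D]_(n, p)) : 'M[formal_sum (C * D)%type]_(m, p) :=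
  \matrix_(i, j) (\sum_k pair_mul (P i k) (Q k j))%R.

Definition symbolic_mulr (m n p : nat) (C : finType)
    (P : 'M[formal_sum C]_(m, n)) (X : 'M[nat]_(n, p)) :
  'M[formal_sum C]_(m, p) := \matrix_(i, j) (\sum_k P i k *+ X k j)%R.

Definition symbolic_mull (m n p : nat) (C : finType) (X : 'M[nat]_(m, n))
    (P : 'M[formal_sum C]_(n, p)) : 'M[formal_sum C]_(m, p) :=
  \matrix_(i, j) (\sum_k P k j *+ X i k)%R.

(* The semigroup ring of G over the nonnegative integers. *)
Definition semigroup_ring (G : finGroupType) := formal_sum G.

Section SemigroupRing.
Variable G : finGroupType.
Implicit Types a b c : semigroup_ring G.

HB.instance Definition _ := GRing.Nmodule.copy (semigroup_ring G) (formal_sum G).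

Definition sr_one : semigroup_ring G := symbol 1%g.
Definition sr_mul a b : semigroup_ring G :=
  [ffun g => \sum_h a h * b (h^-1 * g)%g]%N.

Fact sr_mulA : associative sr_mul.
Proof.
move=> a b c; apply/ffunP => g; rewrite !ffunE.
under eq_bigr do rewrite ffunE big_distrr.
under [RHS]eq_bigr do rewrite ffunE big_distrl.
rewrite [RHS]exchange_big; apply: eq_bigr => h _ /=.
rewrite [RHS](reindex_inj (mulgI h)) /=; apply: eq_bigr => k _.
by rewrite mulKg invMg mulnA -!mulgA.
Qed.

Fact sr_mul1l : left_id sr_one sr_mul.
Proof.
move=> a; apply/ffunP => g; rewrite ffunE (bigD1 1%g) //= big1 => [|h /negPf h1].
  by rewrite ffunE eqxx mul1n addn0 invg1 mul1g.
by rewrite ffunE h1.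
Qed.

Fact sr_mul1r : right_id sr_one sr_mul.
Proof.
move=> a; apply/ffunP => g; rewrite ffunE (bigD1 g) //= big1 => [|h hg].
  by rewrite ffunE mulVg eqxx muln1 addn0.
by rewrite ffunE -eq_mulVg1 (negPf hg) muln0.
Qed.

Fact sr_mulDl : left_distributive sr_mul +%R.
Proof.
move=> a b c; apply/ffunP => g; rewrite !ffunE -big_split /=.
by apply: eq_bigr => h _; rewrite ffunE mulnDl.
Qed.

Fact sr_mulDr : right_distributive sr_mul +%R.
Proof.
move=> a b c; apply/ffunP => g; rewrite !ffunE -big_split /=.
by apply: eq_bigr => h _; rewrite ffunE mulnDr.
Qed.

Fact sr_mul0l : left_zero 0%R sr_mul.
Proof. by move=> a; apply/ffunP => g; rewrite !ffunE big1 // => h _; rewrite ffunE. Qed.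

Fact sr_mul0r : right_zero 0%R sr_mul.
Proof.
by move=> a; apply/ffunP => g; rewrite !ffunE big1 // => h _; rewrite ffunE muln0.
Qed.

HB.instance Definition _ := GRing.Nmodule_isPzSemiRing.Build (semigroup_ring G)
  sr_mulA sr_mul1l sr_mul1r sr_mulDl sr_mulDr sr_mul0l sr_mul0r.

End SemigroupRing.

Definition zero_one (m n : nat) (X : 'M[nat]_(m, n)) : Prop :=
  forall i j, X i j = 0%N \/ X i j = 1%N.

Definition no_zero_line (T : nmodType) (m n : nat) (A : 'M[T]_(m, n)) : Prop :=
  (forall i, exists j, A i j <> 0%R) /\ (forall j, exists i, A i j <> 0%R).

Record symbolic_system (Sigma : finType) := SymbolicSystem {
  dim : nat -> nat;
  Mx : forall l, 'M[formal_sum Sigma]_(dim l, dim l.+1);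
  Ix : forall l, 'M[nat]_(dim l, dim l.+1);
  Mx_no_zero_line : forall l, no_zero_line (Mx l);
  Ix_zero_one : forall l, zero_one (Ix l);
  Ix_no_zero_line : forall l, no_zero_line (Ix l);
  Ix_col : forall l j, exists! i, Ix l i j = 1%N;
  Mx_Ix : forall l,
    symbolic_mull (Ix l) (Mx l.+1) = symbolic_mulr (Mx l) (Ix l.+1) }.

(* [S] is the symbolic matrix system of [L] with respect to an arbitrary
   enumeration [v l] of each vertex set [vertex L l]. *)
Definition associated (Sigma : finType) (S : symbolic_system Sigma)
    (L : lambda_graph Sigma) : Prop :=
  exists v : forall l, 'I_(dim S l) -> vertex L l,
    [/\ forall l, bijective (v l),
        forall l i j, Mx S l i j =
          (\sum_(e : edge L l | (src e == v l i) && (tgt e == v l.+1 j))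
             symbol (lab e))%R &
        forall l i j, Ix S l i j = (iota (v l.+1 j) == v l i)].

Lemma associated_exists (Sigma : finType) (L : lambda_graph Sigma) :
  exists S : symbolic_system Sigma, associated S L.
Proof.
pose w l (u : vertex L l) (v : vertex L l.+1) : formal_sum Sigma :=
  (\sum_(e : edge L l | (src e == u) && (tgt e == v)) symbol (lab e))%R.
have w0 l (e : edge L l) : w l (src e) (tgt e) <> 0%R.
  move=> /ffunP/(_ (lab e)); rewrite sum_ffunE (bigD1 e) ?eqxx //= !ffunE eqxx.
  by lia.
pose M l : 'M[formal_sum Sigma]_(#|vertex L l|, #|vertex L l.+1|) :=
  (\matrix_(i, j) w l (enum_val i) (enum_val j))%R.
pose I l : 'M[nat]_(#|vertex L l|, #|vertex L l.+1|) :=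
  (\matrix_(i, j) (iota (enum_val j) == enum_val i : nat))%R.
have Mnz l : no_zero_line (M l).
  split=> [i|j].
    have [e ei] := has_out (enum_val i); exists (enum_rank (tgt e)).
    by rewrite mxE enum_rankK -ei; exact: w0.
  have [e ej] := has_in (enum_val j); exists (enum_rank (src e)).
  by rewrite mxE enum_rankK -ej; exact: w0.
have I01 l : zero_one (I l) by move=> i j; rewrite mxE; case: eqP; [right|left].
have Inz l : no_zero_line (I l).
  split=> [i|j].
    have [u ui] := iota_surj (enum_val i); exists (enum_rank u).
    by rewrite mxE enum_rankK ui eqxx.
  by exists (enum_rank (iota (enum_val j))); rewrite mxE enum_rankK eqxx.
have Icol l j : exists! i, I l i j = 1%N.
  exists (enum_rank (iota (enum_val j))); split=> [|i].
    by rewrite mxE enum_rankK eqxx.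
  by rewrite mxE; case: eqP => // -> _; rewrite enum_valK.
have comm l : symbolic_mull (I l) (M l.+1) = symbolic_mulr (M l) (I l.+1).
  apply/matrixP => i j; rewrite !mxE.
  set u := enum_val i; set v := enum_val j.
  transitivity (\sum_(x : vertex L l.+1) w l.+1 x v *+ (iota x == u))%R.
    rewrite [RHS](reindex (@enum_val _ (vertex L l.+1))).
      by apply: eq_bigr => k _; rewrite !mxE.
    exact: onW_bij (enum_val_bij _).
  transitivity (\sum_(x : vertex L l.+1) w l u x *+ (iota v == x))%R; last first.
    rewrite [LHS](reindex (@enum_val _ (vertex L l.+1))).
      by apply: eq_bigr => k _; rewrite !mxE.
    exact: onW_bij (enum_val_bij _).
  have [f [fbij flab]] := local_property u v.
  transitivity (\sum_(e : edge L l.+1 | (tgt e == v) && (iota (src e) == u))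
      symbol (lab e))%R.
    rewrite [RHS](partition_big (@src _ _ l.+1) predT) //=.
    apply: eq_bigr => x _; rewrite /w -sumrMnl.
    rewrite [RHS](eq_bigl (fun e => ((src e == x) && (tgt e == v)) && (iota x == u))).
      by rewrite [RHS]big_mkcondr; apply: eq_bigr => e _; case: eqP.
    by move=> e; case: (src e =P x) => [->|]; rewrite ?andbT ?andbF.
  transitivity (\sum_(e : edge L l | (src e == u) && (tgt e == iota v))
      symbol (lab e))%R.
    rewrite [LHS](big_sub [pred e : edge L l.+1 | (tgt e == v) && (iota (src e) == u)]).
    rewrite [RHS](big_sub [pred e : edge L l | (src e == u) && (tgt e == iota v)]).
    rewrite [RHS](reindex f) /=; last exact: onW_bij fbij.
    by apply: eq_bigr => e _; rewrite flab.
  rewrite [RHS](bigD1 (iota v)) //= eqxx mulr1n [X in (_ + X)%R]big1 ?addr0 // => x /negPf xv.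
  by rewrite eq_sym xv mulr0n.
exists (SymbolicSystem Mnz I01 Inz Icol comm), (fun l => @enum_val _ (vertex L l)).
split=> [l|l i j|l i j]; [exact: enum_val_bij | by rewrite mxE..].
Qed.

Definition group_mx (G : finGroupType) (C : finType) (ell : C -> G) (m n : nat)
    (P : 'M[formal_sum C]_(m, n)) : 'M[semigroup_ring G]_(m, n) :=
  map_mx (fun a => substitute ell a : semigroup_ring G) P.

(* The last factors have [sse_n (2l + 2)] columns, and [l.+1.*2] reduces to
   [l.*2.+2]; [castmx] only transports along [sse_n (2l) = m(l)]. *)
Record proper_sse1 (Sigma Sigma' : finType) (S : symbolic_system Sigma)
    (S' : symbolic_system Sigma') := ProperSSE1 {
  sse_C : finType;
  sse_D : finType;
  sse_spec : Sigma -> sse_C * sse_D;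
  sse_spec' : Sigma' -> sse_D * sse_C;
  sse_spec_inj : injective sse_spec;
  sse_spec'_inj : injective sse_spec';
  sse_n : nat -> nat;
  sse_n' : nat -> nat;
  sse_n_nondecreasing : forall l, (sse_n l <= sse_n l.+1)%N;
  sse_n'_nondecreasing : forall l, (sse_n' l <= sse_n' l.+1)%N;
  sse_n_even : forall l, sse_n l.*2 = dim S l;
  sse_n'_even : forall l, sse_n' l.*2 = dim S' l;
  sse_P : forall l, 'M[formal_sum sse_C]_(sse_n l, sse_n' l.+1);
  sse_Q : forall l, 'M[formal_sum sse_D]_(sse_n' l, sse_n l.+1);
  sse_X : forall l, 'M[nat]_(sse_n l, sse_n l.+1);
  sse_X' : forall l, 'M[nat]_(sse_n' l, sse_n' l.+1);
  sse_X_zero_one : forall l, zero_one (sse_X l);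
  sse_X'_zero_one : forall l, zero_one (sse_X' l);
  sse_Mx_PQ : forall l, map_mx (substitute sse_spec) (Mx S l) =
    castmx (sse_n_even l, sse_n_even l.+1)
      (symbolic_mul (sse_P l.*2) (sse_Q l.*2.+1));
  sse_Mx'_QP : forall l, map_mx (substitute sse_spec') (Mx S' l) =
    castmx (sse_n'_even l, sse_n'_even l.+1)
      (symbolic_mul (sse_Q l.*2) (sse_P l.*2.+1));
  sse_Ix_XX : forall l, Ix S l =
    castmx (sse_n_even l, sse_n_even l.+1) (sse_X l.*2 *m sse_X l.*2.+1)%R;
  sse_Ix'_XX : forall l, Ix S' l =
    castmx (sse_n'_even l, sse_n'_even l.+1) (sse_X' l.*2 *m sse_X' l.*2.+1)%R;
  sse_X_P : forall l,
    symbolic_mull (sse_X l) (sse_P l.+1) =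
    symbolic_mulr (sse_P l) (sse_X' l.+1);
  sse_X_Q : forall l,
    symbolic_mull (sse_X' l) (sse_Q l.+1) =
    symbolic_mulr (sse_Q l) (sse_X l.+1) }.

Record group_system (G : finGroupType) := GroupSystem {
  alphabet : finType;
  system : symbolic_system alphabet;
  weight : alphabet -> G }.

Arguments weight {G} _ _.

Definition proper_gsse1 (G : finGroupType) (A B : group_system G) : Prop :=
  exists (w : proper_sse1 (system A) (system B))
      (ellC : sse_C w -> G) (ellD : sse_D w -> G),
    [/\ forall a, weight A a =
          (ellC (sse_spec w a).1 * ellD (sse_spec w a).2)%g,
        forall b, weight B b =
          (ellD (sse_spec' w b).1 * ellC (sse_spec' w b).2)%g,
        forall l, group_mx (weight A) (Mx (system A) l) =
          castmx (sse_n_even w l, sse_n_even w l.+1)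
            (group_mx ellC (sse_P w l.*2) *m group_mx ellD (sse_Q w l.*2.+1))%R &
        forall l, group_mx (weight B) (Mx (system B) l) =
          castmx (sse_n'_even w l, sse_n'_even w l.+1)
            (group_mx ellD (sse_Q w l.*2) *m group_mx ellC (sse_P w l.*2.+1))%R].

Definition proper_gsse (G : finGroupType) (A B : group_system G) : Prop :=
  clos_trans (group_system G) (@proper_gsse1 G) A B.

(* Main.v *)
(* (1) => (2): if phi(x_i) = c_i d_i, the equations M = PQ and M' = QP make
   x |-> y with phi'(y_i) = d_i c_(i+1) a conjugacy, words being transported by
   moving paths one half-level up with X_l P_(l+1) = P_l X'_(l+1), and
   gamma(x) = ell_C(c_0) is a transfer function.
   (2) <=> (3): a point of the extension is a pair (g_0, x) with
   g_(n+1) = g_n ell(x_n), so Phi and gamma act by (g_0, x) |-> (g_0 gamma(x), Phi(x)).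
   (2) => (1): on the space Z = Lambda, every finite-valued s : Z -> A presents a
   subshift, namely that of the itineraries of s. If c, d : Z -> C, D, then the
   canonical systems of the presentations (c, d) and (d, c T) are properly strong
   shift equivalent in 1-step: P_l, Q_l and X_l, X'_l describe the past
   equivalence classes of the interleaved sequences c d c d ... and d c d c ...
   Writing s[i,j] for the window (s T^i, ..., s T^j), such steps lead from the
   time-zero presentation s of Lambda to that, t, of Lambda':
   s ~ s[0,2k] ~ s[0,2k+1] ~ (s[0,2k+1] T^M, t[k,k+N]) ~ t[k,k+N] ~ t[0,N] ~ t,
   where k and N come from the finite memory of Phi, gamma and Phi^-1, and the
   weights are changed by the coboundary of gamma in the second step. *)
From mathcomp Require Import all_boot all_algebra all_fingroup.
From mathcomp Require Import boolp classical_sets cardinality functions topology.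
From mathcomp Require Import zify.
From Stdlib Require Import Relation_Operators.
Require Import Defs.

Set Implicit Arguments.
Unset Strict Implicit.
Unset Printing Implicit Defensive.

Import GRing.Theory.

(** * Locally constant functions on subshifts *)

Section LocallyConstant.
Local Open Scope classical_set_scope.

Definition agree (Sigma : finType) (k : nat) (x y : full_shift Sigma) : Prop :=
  forall i : int, (`|i| <= k)%N -> x i = y i.

Lemma agree_leq (Sigma : finType) k m (x y : full_shift Sigma) :
  (k <= m)%N -> agree m x y -> agree k x y.
Proof. by move=> km xy i ik; apply: xy; exact: leq_trans km. Qed.

Lemma nbhs_coord (Sigma : finType) (x : full_shift Sigma) (i : int) :
  nbhs x [set y : full_shift Sigma | y i = x i].
Proof.
have := @proj_continuous _ (fun=> discrete_topology Sigma) i x.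
by move=> /(_ [set x i]); apply; exact: discrete_set1.
Qed.

Lemma nbhs_agree (Sigma : finType) (x : full_shift Sigma) k :
  nbhs x [set y | agree k x y].
Proof.
apply: (@filterS _ (nbhs x) _
    [set y | forall j : 'I_k.*2.+1, y (j%:Z - k%:Z)%R = x (j%:Z - k%:Z)%R]).
  move=> y xy i ik.
  have lt : (`|(i + k%:Z)%R|%N < k.*2.+1)%N by lia.
  have -> : i = ((Ordinal lt)%:Z - k%:Z)%R by rewrite /=; lia.
  by rewrite xy.
apply: (@filter_forall (full_shift Sigma) 'I_k.*2.+1
    (fun j => [set y : full_shift Sigma | y (j%:Z - k%:Z)%R = x (j%:Z - k%:Z)%R])
    (nbhs x) _) => j.
exact: nbhs_coord.
Qed.

(** The product topology is the supremum of the coordinate topologies, so it is enough that the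
    filter generated by the agreement sets converges in each coordinate. *)
Lemma nbhs_agree_sub (Sigma : finType) (x : full_shift Sigma)
    (U : set (full_shift Sigma)) :
  nbhs x U -> exists k, [set y | agree k x y] `<=` U.
Proof.
pose F : set_system (full_shift Sigma) :=
  filter_from [set: nat] (fun k => [set y | agree k x y]).
have FF : Filter F.
  apply: filter_from_filter; first by exists 0%N.
  move=> i j _ _; exists (maxn i j) => // y xy.
  by split; apply: agree_leq xy; rewrite ?leq_maxl ?leq_maxr.
have Fx : F --> x.
  apply/cvg_sup => i V [_ [[W oW <-] Wx WV]].
  by exists `|i|%N => // y xy; apply: WV; rewrite /= -(xy i).
by move=> /Fx [k _ kU]; exists k.
Qed.

(** Continuity into a discrete space. The radius depends on the point here; [local_uniform] removes
    this dependence. *)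
Definition local (Sigma : finType) (X : subshift Sigma) (T : Type) (f : X -> T) :=
  forall x, exists k, forall y, agree k (val x) (val y) -> f y = f x.

Lemma local_map2 (Sigma : finType) (X : subshift Sigma) (T U V : Type)
    (F : T -> U -> V) (f : X -> T) (g : X -> U) :
  local f -> local g -> local (fun x => F (f x) (g x)).
Proof.
move=> lf lg x; have [k fk] := lf x; have [m gm] := lg x.
exists (maxn k m) => y xy.
by rewrite (fk y (agree_leq (leq_maxl _ _) xy)) (gm y (agree_leq (leq_maxr _ _) xy)).
Qed.

Lemma nbhs_subshift (Sigma : finType) (X : subshift Sigma) (x : X) U :
  nbhs x U <-> exists k, forall y : X, agree k (val x) (val y) -> U y.
Proof.
split.
  move=> [_ [[W oW <-] Wx WU]].
  have [|k kW] := @nbhs_agree_sub _ (val x) W; first exact: open_nbhs_nbhs.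
  by exists k => y /kW; exact: WU.
move=> [k kU]; apply: (@filterS _ (nbhs x) _ _ _ kU).
exact: (initial_continuous (f := val : X -> full_shift Sigma) (nbhs_agree (val x) k)).
Qed.

Lemma continuous_local (Sigma : finType) (X : subshift Sigma) (T : choiceType)
    (f : X -> discrete_topology T) : continuous f <-> local f.
Proof.
split=> [cf x|lf x U /nbhs_singleton Ux].
  have /nbhs_subshift[k kf] := cf x [set f x] (discrete_set1 _).
  by exists k.
have [k kf] := lf x; apply/nbhs_subshift; exists k => y /kf fy.
by rewrite /preimage /mkset fy.
Qed.

Lemma continuous_subshift (Sigma Sigma' : finType) (X : subshift Sigma)
    (Y : subshift Sigma') (f : X -> Y) :
  continuous f <-> forall i, local (fun x => val (f x) i).
Proof.
split=> [cf i x|lf x U /nbhs_subshift[k kU]].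
  have /cf/nbhs_subshift[k kU] : nbhs (f x) [set y | val y i = val (f x) i].
    by apply/nbhs_subshift; exists `|i|%N => y /(_ i)->.
  by exists k => y /kU.
have [h hP] := choice (fun i : int => lf i x).
(* Only the [2k+1] coordinates from [-k] to [k] of the image matter; the largest of their radii
   serves all of them. *)
apply/nbhs_subshift; exists (\max_(j < k.*2.+1) h (j%:Z - k%:Z)%R)%N => y xy.
apply: kU => i ik; apply/esym/hP; apply: agree_leq xy.
have lt : (`|(i + k%:Z)%R|%N < k.*2.+1)%N by lia.
have {1}-> : i = ((Ordinal lt)%:Z - k%:Z)%R by rewrite /=; lia.
exact: leq_bigmax.
Qed.

Lemma compact_full_shift (Sigma : finType) : compact [set: full_shift Sigma].
Proof.
have := @tychonoff int (fun=> discrete_topology Sigma) (fun=> setT).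
rewrite (_ : [set f | _] = setT); last by apply/seteqP; split.
apply => i; apply: finite_compact; exact: (@finite_finset Sigma).
Qed.

(** Otherwise there are pairs agreeing on ever larger windows with different values. By compactness
    their first members have a cluster point, and far enough in the sequence both members of some
    pair lie where [f] is constant around it. *)
Lemma local_uniform (Sigma : finType) (X : subshift Sigma) (T : Type) (f : X -> T) :
  local f -> exists k, forall x y : X, agree k (val x) (val y) -> f x = f y.
Proof.
move=> lf; apply: contrapT => /forallNP nk.
have H k : exists xy : X * X,
    agree k (val xy.1) (val xy.2) /\ f xy.1 <> f xy.2.
  have /existsNP[x /existsNP[y /not_implyP[xy fxy]]] := nk k.
  by exists (x, y).
have [u uP] := choice H.
pose F : set_system (full_shift Sigma) :=
  filter_from [set: nat] (fun k => [set val (u n).1 | n in [set n | (k <= n)%N]]).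
have FF : ProperFilter F.
  apply: filter_from_proper; last by move=> k _; exists (val (u k).1), k => /=.
  apply: filter_from_filter; first by exists 0%N.
  move=> i j _ _; exists (maxn i j) => // _ [n + <-].
  by rewrite /= geq_max => /andP[ni nj]; split; exists n.
have cX : compact X.
  apply: subclosed_compact (@compact_full_shift Sigma) _ => //.
  exact: points_closed.
have FX : F X by exists 0%N => // _ [n _ <-]; exact/set_mem/valP.
have [x [Xx Fx]] := cX F FF FX.
pose x' : X := SigSub (mem_set Xx).
have [k kf] := lf x'.
have Fk : F [set val (u n).1 | n in [set n | (k <= n)%N]] by exists k.
have [_ [[n /= kn <-] xn]] := Fx _ _ Fk (nbhs_agree x k).
have [un fn] := uP n; apply: fn; rewrite (kf (u n).1) // (kf (u n).2) // => i ik.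
by rewrite /= (xn i ik); apply: un; exact: leq_trans kn.
Qed.

End LocallyConstant.

(** * Powers of the shift, and subshifts defined by a set of words *)

Section Subshifts.
Local Open Scope classical_set_scope.

Definition shiftz (Sigma : finType) (j : int) (x : full_shift Sigma) :
  full_shift Sigma := fun i => x (i + j)%R.

Lemma shiftz_in (Sigma : finType) (X : subshift Sigma) (j : int) (x : X) :
  shiftz j (val x) \in (X : set (full_shift Sigma)).
Proof.
apply/mem_set; have Xx := set_mem (valP x).
have E := points_shift X.
have shiftS (y : full_shift Sigma) : points X y -> points X (shiftz 1 y).
  by move=> Xy; rewrite -E; exists y.
(* Backward invariance holds because the shift maps [X] onto itself: [y] is the shift of some point
   of [X]. *)
have shiftP (y : full_shift Sigma) : points X y -> points X (shiftz (-1) y).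
  rewrite -{1}E => -[z Xz <-]; suff -> : shiftz (-1) (shift z) = z by [].
  by apply/funext => i; rewrite /shiftz /shift subrK.
have shiftM k m (y : full_shift Sigma) : shiftz k (shiftz m y) = shiftz (k + m) y.
  by apply/funext => i; rewrite /shiftz addrA.
case: j => n.
  elim: n => [|n IH]; last by rewrite -add1n PoszD -shiftM; exact: shiftS.
  by rewrite (_ : shiftz _ _ = val x) //; apply/funext => i; rewrite /shiftz addr0.
rewrite NegzE; elim: n => [|n IH]; first exact: shiftP.
by rewrite -add1n PoszD opprD -shiftM; exact: shiftP.
Qed.

Definition shiftz_on (Sigma : finType) (X : subshift Sigma) (j : int) (x : X) : X :=
  SigSub (shiftz_in j x).

Lemma shiftz_on1 (Sigma : finType) (X : subshift Sigma) (x : X) :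
  shiftz_on 1 x = shift_on x.
Proof. exact: val_inj. Qed.

Lemma shiftz_onD (Sigma : finType) (X : subshift Sigma) i j (x : X) :
  shiftz_on i (shiftz_on j x) = shiftz_on (i + j)%R x.
Proof. by apply: val_inj; apply/funext => k /=; rewrite /shiftz addrA. Qed.

Lemma shiftz_on0 (Sigma : finType) (X : subshift Sigma) (x : X) :
  shiftz_on 0 x = x.
Proof. by apply: val_inj; apply/funext => k /=; rewrite /shiftz addr0. Qed.

Lemma subshift_eq (Sigma : finType) (X Y : subshift Sigma) :
  points X = points Y -> X = Y.
Proof.
case: X Y => [X cX sX] [Y cY sY] /= XY; case: _ / XY cY sY => cY sY.
by rewrite (Prop_irrelevance cX cY) (Prop_irrelevance sX sY).
Qed.

Definition language_points (Sigma : finType) (P : seq Sigma -> Prop) :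
  set (full_shift Sigma) := [set x | forall i n, P (word_at x i n)].

Lemma language_closed (Sigma : finType) (P : seq Sigma -> Prop) :
  closed (language_points P).
Proof.
move=> x clx i n.
have [y [Py xy]] := clx _ (nbhs_agree x (`|i| + n)).
suff <- : word_at y i n = word_at x i n by exact: Py.
apply: eq_from_tnth => k; rewrite !tnth_mktuple -xy //.
by have := ltn_ord k; lia.
Qed.

Lemma language_shift (Sigma : finType) (P : seq Sigma -> Prop) :
  @shift Sigma @` language_points P = language_points P.
Proof.
apply/seteqP; split=> [_ [x Px <-] i n|x Px]; first by rewrite word_at_shift.
have xE : shift (shiftz (-1) x) = x.
  by apply/funext => i; rewrite /shift /shiftz addrK.
exists (shiftz (-1) x) => // i n.
by rewrite -(subrK 1%R i) -word_at_shift xE.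
Qed.

Definition language_subshift (Sigma : finType) (P : seq Sigma -> Prop) :
  subshift Sigma := Subshift (@language_closed _ P) (@language_shift _ P).

End Subshifts.

Section SystemSubshift.

(** A chain of equivalences passes through symbolic systems given without a lambda-graph, so words
    and subshifts are attached to the matrices themselves. Only the supports of the entries
    count. *)
Fixpoint mx_reads (Sigma : finType) (S : symbolic_system Sigma) (w : seq Sigma) :
    forall l, 'I_(dim S l) -> Prop :=
  if w is a :: w' then
    fun l i => exists j, Mx S l i j a <> 0%N /\ mx_reads w' j
  else fun _ _ => True.

Definition mx_word (Sigma : finType) (S : symbolic_system Sigma) (w : seq Sigma) :=
  exists l (i : 'I_(dim S l)), mx_reads w i.

Definition system_subshift (Sigma : finType) (S : symbolic_system Sigma) :
  subshift Sigma := language_subshift (mx_word S).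

Lemma sum_symbolE (A : finType) (E : finType) (P : pred E) (f : E -> A) a :
  (\sum_(e | P e) symbol (f e))%R a = #|[set e | P e && (f e == a)]|.
Proof.
rewrite sum_ffunE -sum1dep_card big_mkcondr.
by apply: eq_bigr => e _; rewrite ffunE eq_sym; case: eqP.
Qed.

Lemma associated_subshift (Sigma : finType) (S : symbolic_system Sigma)
    (L : lambda_graph Sigma) :
  associated S L -> presented L = system_subshift S.
Proof.
move=> [v [vbij vM _]]; apply: subshift_eq => /=.
have rS w l (i : 'I_(dim S l)) : reads w (v l i) <-> mx_reads w i.
  elim: w l i => //= a w IH l i; split.
    move=> [e [se le re]]; have [v' _ v'K] := vbij l.+1; exists (v' (tgt e)).
    split; last by apply/IH; rewrite v'K.
    rewrite vM sum_symbolE v'K; apply/eqP; rewrite -lt0n card_gt0; apply/set0Pn.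
    by exists e; rewrite inE se le !eqxx.
  move=> [j [/eqP + /IH rj]].
  rewrite vM sum_symbolE -lt0n card_gt0 => /set0Pn[e].
  by rewrite inE => /andP[/andP[/eqP se /eqP te] /eqP le]; exists e; rewrite te.
apply/funext => x; apply/propext; split=> Px i n; have [l] := Px i n.
  move=> [u ru]; have [v' _ v'K] := vbij l; exists l, (v' u).
  by apply/rS; rewrite v'K.
by move=> [j rj]; exists l, (v l j); apply/rS.
Qed.

End SystemSubshift.

(** * Subshifts of symbolic matrix systems *)

Section MatrixSupport.

Lemma natr_mulrn (x n : nat) : (x *+ n)%R = (x * n)%N.
Proof. by elim: n => [|n IH]; rewrite ?mulr0n ?muln0 // mulrS IH mulnS. Qed.

Lemma sum_neq0 (T : finType) (F : T -> nat) :
  (\sum_k F k)%N <> 0%N <-> exists k, F k <> 0%N.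
Proof.
split=> [H|[k Fk] /eqP].
  apply: contrapT => /forallNP F0; apply: H; rewrite big1 // => k _.
  exact: contrapT (F0 k).
by rewrite sum_nat_eq0 => /forallP/(_ k)/eqP.
Qed.

Lemma muln_neq0 m n : (m * n)%N <> 0%N <-> m <> 0%N /\ n <> 0%N.
Proof.
split=> [/eqP|[/eqP/negPf m0 /eqP/negPf n0]]; last first.
  by apply/eqP; rewrite muln_eq0 m0 n0.
by rewrite muln_eq0 negb_or => /andP[/eqP m0 /eqP n0].
Qed.

Lemma symbolic_mulE m n p (C D : finType) (P : 'M[formal_sum C]_(m, n))
    (Q : 'M[formal_sum D]_(n, p)) i j c :
  symbolic_mul P Q i j c = (\sum_k P i k c.1 * Q k j c.2)%N.
Proof. by rewrite mxE sum_ffunE; apply: eq_bigr => k _; rewrite ffunE. Qed.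

Lemma symbolic_mulrE m n p (C : finType) (P : 'M[formal_sum C]_(m, n))
    (X : 'M[nat]_(n, p)) i j c :
  symbolic_mulr P X i j c = (\sum_k P i k c * X k j)%N.
Proof.
rewrite mxE sum_ffunE; apply: eq_bigr => k _.
by rewrite ffunMnE natr_mulrn.
Qed.

Lemma symbolic_mullE m n p (C : finType) (X : 'M[nat]_(m, n))
    (P : 'M[formal_sum C]_(n, p)) i j c :
  symbolic_mull X P i j c = (\sum_k X i k * P k j c)%N.
Proof.
rewrite mxE sum_ffunE; apply: eq_bigr => k _.
by rewrite ffunMnE natr_mulrn mulnC.
Qed.

Lemma nat_mulmxE m n p (X : 'M[nat]_(m, n)) (Y : 'M[nat]_(n, p)) i j :
  (X *m Y)%R i j = (\sum_k X i k * Y k j)%N.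
Proof. by rewrite mxE. Qed.

Lemma sum_mul_neq0 (T : finType) (F G : T -> nat) :
  (\sum_k F k * G k)%N <> 0%N <-> exists k, F k <> 0%N /\ G k <> 0%N.
Proof.
rewrite sum_neq0.
by split=> -[k FG]; exists k; apply/muln_neq0.
Qed.

Lemma substituteE (S T : finType) (f : S -> T) (m : formal_sum S) a :
  injective f -> substitute f m (f a) = m a.
Proof.
move=> fI; rewrite ffunE (big_pred1 a) // => s.
exact: inj_eq.
Qed.

Lemma substitute_neq0 (S T : finType) (f : S -> T) (m : formal_sum S) t :
  substitute f m t <> 0%N <-> exists s, f s = t /\ m s <> 0%N.
Proof.
rewrite ffunE; split.
  rewrite big_mkcond => /sum_neq0[s]; case: eqP => // fs ms.
  by exists s.
by move=> [s [fs /eqP ms]]; rewrite (bigD1 s) ?fs ?eqxx //=; case: (m s) ms.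
Qed.

End MatrixSupport.

(** * Moving words by half a level along a one-step equivalence *)

Section HalfStep.
Variables (Sigma Sigma' : finType).

(** The roles of P and Q are symmetric. This yields the inverse conjugacy and the symmetry of the
    equivalence relation. *)
Definition sse_swap (S : symbolic_system Sigma) (S' : symbolic_system Sigma')
    (w : proper_sse1 S S') : proper_sse1 S' S :=
  ProperSSE1 (@sse_spec'_inj _ _ _ _ w) (@sse_spec_inj _ _ _ _ w)
    (sse_n'_nondecreasing w) (sse_n_nondecreasing w)
    (@sse_X'_zero_one _ _ _ _ w) (@sse_X_zero_one _ _ _ _ w)
    (sse_Mx'_QP w) (sse_Mx_PQ w) (sse_Ix'_XX w) (sse_Ix_XX w)
    (sse_X_Q w) (sse_X_P w).

Variables (S : symbolic_system Sigma) (S' : symbolic_system Sigma').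
Variable w : proper_sse1 S S'.

Let even_ord l (i : 'I_(sse_n w l.*2)) : 'I_(dim S l) :=
  cast_ord (sse_n_even w l) i.
Let even_ord' l (i : 'I_(sse_n' w l.*2)) : 'I_(dim S' l) :=
  cast_ord (sse_n'_even w l) i.

Lemma sse_MxP l (i : 'I_(sse_n w l.*2)) (j : 'I_(sse_n w l.+1.*2)) a :
  Mx S l (even_ord i) (even_ord j) a <> 0%N <->
  exists k, sse_P w l.*2 i k (sse_spec w a).1 <> 0%N /\
            sse_Q w l.*2.+1 k j (sse_spec w a).2 <> 0%N.
Proof.
rewrite -sum_mul_neq0 -symbolic_mulE -(substituteE _ _ (@sse_spec_inj _ _ _ _ w)).
have := sse_Mx_PQ w l => /matrixP/(_ (even_ord i) (even_ord j)).
by rewrite mxE castmxE /= !cast_ordK => ->.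
Qed.

Lemma sse_MxP' l (i : 'I_(sse_n' w l.*2)) (j : 'I_(sse_n' w l.+1.*2)) k c d :
  sse_Q w l.*2 i k d <> 0%N -> sse_P w l.*2.+1 k j c <> 0%N ->
  exists b, sse_spec' w b = (d, c) /\
    Mx S' l (even_ord' i) (even_ord' j) b <> 0%N.
Proof.
move=> ik kj.
have := sse_Mx'_QP w l => /matrixP/(_ (even_ord' i) (even_ord' j)).
rewrite mxE castmxE /= !cast_ordK => E; apply/substitute_neq0; rewrite E.
by rewrite symbolic_mulE; apply/sum_mul_neq0; exists k.
Qed.

Lemma sse_X_even_row l (i : 'I_(sse_n w l.*2)) : exists j, sse_X w l.*2 i j <> 0%N.
Proof.
have [j] := (Ix_no_zero_line S l).1 (even_ord i).
rewrite (sse_Ix_XX w l) castmxE /= cast_ordK nat_mulmxE.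
by move=> /sum_mul_neq0[k [ik _]]; exists k.
Qed.

Lemma sse_raise_P l i j k c :
  sse_P w l i j c <> 0%N -> sse_X' w l.+1 j k <> 0%N ->
  exists m, sse_X w l i m <> 0%N /\ sse_P w l.+1 m k c <> 0%N.
Proof.
move=> ij jk; apply/sum_mul_neq0; rewrite -symbolic_mullE sse_X_P symbolic_mulrE.
by apply/sum_mul_neq0; exists j.
Qed.

Lemma sse_raise_Q l i j k d :
  sse_Q w l i j d <> 0%N -> sse_X w l.+1 j k <> 0%N ->
  exists m, sse_X' w l i m <> 0%N /\ sse_Q w l.+1 m k d <> 0%N.
Proof.
move=> ij jk; apply/sum_mul_neq0; rewrite -symbolic_mullE sse_X_Q symbolic_mulrE.
by apply/sum_mul_neq0; exists j.
Qed.

(** The sequence c d c d ... regrouped with an offset of one half step; [d] is the second half of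
    the symbol preceding [u]. *)
Fixpoint half_shift (d : sse_D w) (u : seq Sigma) : seq (sse_D w * sse_C w) :=
  if u is a :: u' then
    (d, (sse_spec w a).1) :: half_shift (sse_spec w a).2 u'
  else [::].

(* The path is raised by one level starting from its end, where the nonzero
   rows of [sse_X] at even levels provide the first lift. *)
Lemma half_step_reads (u : seq Sigma) l (j : 'I_(sse_n' w l.*2.+1))
    (m : 'I_(sse_n w l.+1.*2)) d :
  sse_Q w l.*2.+1 j m d <> 0%N -> mx_reads u (even_ord m) ->
  exists (j' : 'I_(sse_n' w l.+1.*2)) (v : seq Sigma'),
    [/\ sse_X' w l.*2.+1 j j' <> 0%N, mx_reads v (even_ord' j') &
        map (sse_spec' w) v = half_shift d u].
Proof.
elim: u l j m d => [|a u IH] l j m d jm /=.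
  have [m' mm'] := sse_X_even_row m => _.
  by have [j' [jj' _]] := sse_raise_Q jm mm'; exists j', [::].
move=> [k' []]; pose k := cast_ord (esym (sse_n_even w l.+2)) k'.
have -> : k' = even_ord k by rewrite /even_ord /k cast_ordKV.
move=> /(@sse_MxP l.+1 m k)[j2 [mj2 j2k]] /(IH _ _ _ _ j2k)[j2' [v [X2 rv vE]]].
(* With the tail already raised, the P-edge and then the Q-edge before it are raised; together they
   form one edge of [S']. *)
have [m' [mm' mj2']] := sse_raise_P mj2 X2.
have [j' [jj' jm']] := sse_raise_Q jm mm'.
have [b [bE Mb]] := @sse_MxP' l.+1 j' j2' m' _ _ jm' mj2'.
exists j', (b :: v); split=> //=; last by rewrite bE vE.
by exists (even_ord' j2').
Qed.

(** Only the Q-half of the edge of [a] is used, so a word loses one symbol on its way to [S']. *)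
Lemma half_step_word a u : mx_word S (a :: u) ->
  exists v, mx_word S' v /\ map (sse_spec' w) v = half_shift (sse_spec w a).2 u.
Proof.
move=> [l [i' [k' []]]].
have -> : i' = even_ord (cast_ord (esym (sse_n_even w l)) i').
  by rewrite /even_ord cast_ordKV.
have -> : k' = even_ord (cast_ord (esym (sse_n_even w l.+1)) k').
  by rewrite /even_ord cast_ordKV.
move=> /sse_MxP[j [_ jk]] /(half_step_reads jk)[j' [v [_ rv vE]]].
by exists v; split=> //; exists l.+1, (even_ord' j').
Qed.

Lemma word_atE (x : full_shift Sigma) i n :
  word_at x i n = [seq x (i + k%:Z)%R | k <- seq.iota 0 n] :> seq Sigma.
Proof. by rewrite -val_enum_ord -map_comp. Qed.

Lemma half_shift_word_at (x : full_shift Sigma) i n :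
  half_shift (sse_spec w (x i)).2 (word_at x (i + 1)%R n) =
  [seq ((sse_spec w (x (i + k%:Z)%R)).2, (sse_spec w (x (i + k.+1%:Z)%R)).1)
     | k <- seq.iota 0 n].
Proof.
rewrite word_atE.
elim: n i => // n IH i; rewrite /= !addr0; congr (_ :: _).
rewrite -(addn0 1%N) iotaDl -!map_comp.
rewrite -[RHS](_ : [seq ((sse_spec w (x (i + 1 + k%:Z)%R)).2,
   (sse_spec w (x (i + 1 + k.+1%:Z)%R)).1) | k <- seq.iota 0 n] = _).
  rewrite -IH; congr half_shift; apply: eq_map => k /=.
  by congr x; lia.
apply: eq_map => k /=; apply: pair_eq.
  by congr ((sse_spec w (x _)).2); lia.
by congr ((sse_spec w (x _)).1); lia.
Qed.

End HalfStep.

(** * Conjugacies with cohomologous weights *)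

Section WeightConjugacy.
Variable G : finGroupType.

Definition weight_conjugate (Sigma Sigma' : finType) (X : subshift Sigma)
    (Y : subshift Sigma') (ell : Sigma -> G) (ell' : Sigma' -> G) : Prop :=
  exists Phi : X -> Y, conjugacy Phi /\
    cohomologous (tau (X := X) ell) (tau (X := Y) ell' \o Phi).

Lemma weight_conjugate_trans (A B C : finType) (X : subshift A) (Y : subshift B)
    (Z : subshift C) (a : A -> G) (b : B -> G) (c : C -> G) :
  weight_conjugate X Y a b -> weight_conjugate Y Z b c -> weight_conjugate X Z a c.
Proof.
move=> [f [[[cf [f' [fK f'K cf']]] fs] [u [cu ue]]]].
move=> [g [[[cg [g' [gK g'K cg']]] gs] [v [cv ve]]]].
exists (g \o f); split.
  split; last by move=> x; rewrite /= fs gs.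
  split; first by move=> x; exact: continuous_comp (cf x) (cg _).
  exists (f' \o g'); split; [exact: can_comp | exact: can_comp |].
  by move=> x; exact: continuous_comp (cg' x) (cf' _).
(* Transfer functions multiply along a composition, the second one being pulled back by [f]. *)
exists (fun x => ((u x : G) * (v (f x) : G))%g); split.
  apply/continuous_local; apply: local_map2; first exact/continuous_local.
  by apply/continuous_local => y; exact: continuous_comp (cf y) (cv _).
by move=> x; rewrite ue /= ve /= fs invMg !mulgA.
Qed.

(** Words of length one define the coordinates of [y]. As [sse_spec'] is injective, each longer
    transported word coincides with the corresponding window of [y], which is therefore
    admissible. *)
Lemma half_step_point (Sigma Sigma' : finType) (S : symbolic_system Sigma)
    (S' : symbolic_system Sigma') (w : proper_sse1 S S') (x : system_subshift S) :
  exists y : system_subshift S', forall i, sse_spec' w (val y i) =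
    ((sse_spec w (val x i)).2, (sse_spec w (val x (i + 1)%R)).1).
Proof.
have Px := set_mem (valP x).
have word_cons i n : word_at (val x) i n.+1 =
    val x i :: word_at (val x) (i + 1)%R n :> seq _.
  rewrite !word_atE /= addr0 -(addn0 1%N) iotaDl -map_comp; congr (_ :: _).
  by apply: eq_map => k /=; congr (val x _); lia.
have step i n : exists v, mx_word S' v /\ map (sse_spec' w) v =
    [seq ((sse_spec w (val x (i + k%:Z)%R)).2, (sse_spec w (val x (i + k.+1%:Z)%R)).1)
     | k <- seq.iota 0 n].
  have := Px i n.+1; rewrite word_cons => /(half_step_word w)[v [rv vE]].
  by exists v; rewrite vE half_shift_word_at.
have : forall i, exists b, sse_spec' w b =
    ((sse_spec w (val x i)).2, (sse_spec w (val x (i + 1)%R)).1).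
  by move=> i; have [[|b v] [_]] := step i 1%N; rewrite //= addr0 => -[<-]; exists b.
move=> /choice[y yE].
have Py : y \in (system_subshift S' : set (full_shift Sigma')).
  apply/mem_set => i n; have [v [rv vE]] := step i n.
  suff <- : v = word_at y i n by [].
  apply: (inj_map (@sse_spec'_inj _ _ _ _ w)); rewrite vE word_atE -map_comp.
  apply: eq_map => k /=; rewrite yE; apply: pair_eq => //.
  by congr ((sse_spec w (val x _)).1); lia.
by exists (SigSub Py) => i; exact: yE.
Qed.

Lemma sse_weight_conjugate (Sigma Sigma' : finType) (S : symbolic_system Sigma)
    (S' : symbolic_system Sigma') (w : proper_sse1 S S') (ell : Sigma -> G)
    (ell' : Sigma' -> G) (ellC : sse_C w -> G) (ellD : sse_D w -> G) :
  (forall a, ell a = (ellC (sse_spec w a).1 * ellD (sse_spec w a).2)%g) ->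
  (forall b, ell' b = (ellD (sse_spec' w b).1 * ellC (sse_spec' w b).2)%g) ->
  weight_conjugate (system_subshift S) (system_subshift S') ell ell'.
Proof.
move=> ellE ellE'.
have [f fE] := choice (@half_step_point _ _ _ _ w).
have [g gE] := choice (@half_step_point _ _ _ _ (sse_swap w)).
(* The two half steps compose to the full shift, since (d_i, c_(i+1)) is sent to (c_(i+1), d_(i+1));
   the inverse shift corrects this. *)
pose f' y := shiftz_on (-1) (g y).
have f'E y i : sse_spec w (val (f' y) i) =
    ((sse_spec' w (val y (i - 1)%R)).2, (sse_spec' w (val y i)).1).
  by have := gE y (i - 1)%R; rewrite subrK.
have spec_inj := @sse_spec_inj _ _ _ _ w.
have spec_inj' := @sse_spec'_inj _ _ _ _ w.
exists f; split; first split.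
- split.
    apply/continuous_subshift => i x; exists `|i|.+1 => y xy; apply: spec_inj'.
    by rewrite !fE !xy //; lia.
  exists f'; split.
  + move=> x; apply: val_inj; apply/funext => i; apply: spec_inj.
    by rewrite f'E !fE subrK /= -surjective_pairing.
  + move=> y; apply: val_inj; apply/funext => i; apply: spec_inj'.
    by rewrite fE !f'E addrK /= -surjective_pairing.
  + apply/continuous_subshift => i x; exists `|i|.+1 => y xy; apply: spec_inj.
    by rewrite !f'E !xy //; lia.
- by move=> x; apply: val_inj; apply/funext => i; apply: spec_inj'; rewrite !fE.
exists (fun x => ellC (sse_spec w (val x 0%R)).1); split.
  by apply/continuous_local => x; exists 0%N => y xy; rewrite (xy 0%R).
by move=> x; rewrite /tau /= ellE ellE' fE /shift mulgA mulgK.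
Qed.

Lemma gsse_weight_conjugate (A B : group_system G) :
  proper_gsse A B ->
  weight_conjugate (system_subshift (system A)) (system_subshift (system B))
    (weight A) (weight B).
Proof.
elim=> {A B} [A B [w [ellC [ellD [wA wB _ _]]]]|A B C _ IH1 _ IH2].
  exact: sse_weight_conjugate wA wB.
exact: weight_conjugate_trans IH1 IH2.
Qed.

End WeightConjugacy.

(** * Group extensions *)

Section ExtensionPoints.
Variables (G : finGroupType) (Sigma : finType) (L : lambda_graph Sigma).
Variable ell : Sigma -> G.

Let X := presented L.
Let XG := presented (extension L ell).

Fixpoint forward_product (x : full_shift Sigma) (n : nat) : G :=
  if n is m.+1 then (forward_product x m * ell (x m%:Z%R))%g else 1%g.

Fixpoint backward_product (x : full_shift Sigma) (n : nat) : G :=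
  if n is m.+1 then (backward_product x m * (ell (x (- m.+1%:Z)%R))^-1)%g
  else 1%g.

(** The two-sided solution of c_(i+1) = c_i ell(x_i) with c_0 = 1. *)
Definition cocycle (x : full_shift Sigma) (i : int) : G :=
  match i with
  | Posz n => forward_product x n
  | Negz n => backward_product x n.+1
  end.

Lemma cocycleS x i : cocycle x (i + 1)%R = (cocycle x i * ell (x i))%g.
Proof.
case: i => [n|[|n]].
- by rewrite -PoszD addn1.
- by rewrite /= mul1g mulVg.
- rewrite (_ : (Negz n.+1 + 1)%R = Negz n); last by lia.
  by rewrite /= !mulgKV.
Qed.

Lemma cocycle_agree k x y i : (`|i| <= k)%N -> agree k x y ->
  cocycle x i = cocycle y i.
Proof.
have F n : (n <= k)%N -> agree k x y -> forward_product x n = forward_product y n.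
  elim: n => //= n IH nk xy; rewrite IH ?xy //; lia.
have B n : (n <= k)%N -> agree k x y -> backward_product x n = backward_product y n.
  elim: n => //= n IH nk xy; rewrite IH ?xy //; lia.
by case: i => n ik xy; [apply: F | apply: B].
Qed.

(** Right multiplication is injective, so the recursion also runs backwards from 0. *)
Lemma skew_unique (a b : int -> G) (c : int -> G) :
  (forall i, a (i + 1)%R = (a i * c i)%g) ->
  (forall i, b (i + 1)%R = (b i * c i)%g) -> a 0%R = b 0%R -> a =1 b.
Proof.
move=> aS bS ab0; case=> n.
  by elim: n => // n IH; rewrite -addn1 PoszD aS bS IH.
have back i : a (i + 1)%R = b (i + 1)%R -> a i = b i by rewrite aS bS => /mulIg.
elim: n => [|n IH]; apply: back => //.
by rewrite (_ : (Negz n.+1 + 1)%R = Negz n) //; lia.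
Qed.

Lemma reads_ext_proj w l (v : vertex (extension L ell) l) :
  reads w v -> reads (L := L) [seq a.2 | a <- w] v.2.
Proof.
elim: w l v => //= a w IH l v [[k e] [<- <- /IH re]].
by exists e.
Qed.

Lemma reads_ext_lift (x : full_shift Sigma) (c : int -> G) l (v : vertex L l) i n :
  (forall i, c (i + 1)%R = (c i * ell (x i))%g) ->
  reads [seq x (i + k%:Z)%R | k <- seq.iota 0 n] v ->
  reads (L := extension L ell)
    [seq (c (i + k%:Z)%R, x (i + k%:Z)%R) | k <- seq.iota 0 n] (c i, v).
Proof.
move=> cS; elim: n l v i => //= n IH l v i [e [se le]].
have shiftE T (f : int -> T) :
    [seq f (i + k%:Z)%R | k <- seq.iota 1 n] =
    [seq f (i + 1 + k%:Z)%R | k <- seq.iota 0 n].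
  rewrite -(addn0 1%N) iotaDl -map_comp; apply: eq_map => k /=.
  by congr f; lia.
rewrite (shiftE _ x) (shiftE _ (fun j => (c j, x j))) => /IH.
rewrite cS addr0 in le * => re.
by exists (c i, e); rewrite /ext_src /ext_lab /ext_tgt /= se le.
Qed.

(** Along a path of the extension the terminal map dictates the next group component, which words of
    length two detect. Conversely such components lift any path of [L]. *)
Lemma ext_pointP (z : full_shift (G * Sigma)%type) :
  presented_points (extension L ell) z <->
  presented_points L (fun i => (z i).2) /\
  (forall i, (z (i + 1)%R).1 = ((z i).1 * ell (z i).2)%g).
Proof.
split=> [Pz|[Px zS] i n].
  split=> [i n|i].
    have [l [v /reads_ext_proj rv]] := Pz i n; exists l, v.2.
    by move: rv; rewrite !word_atE -map_comp.
  have [l [v]] := Pz i 2%N; rewrite word_atE /= addr0.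
  move=> [[g e] [_ <- [[h f] [hg <- _]]]].
  by have /= -> := congr1 fst hg.
have [l [v]] := Px i n; rewrite word_atE => /(reads_ext_lift zS) rv.
exists l, ((z i).1, v); rewrite word_atE.
by under eq_map => k do rewrite [z _]surjective_pairing.
Qed.

Lemma base_in (z : XG) : (fun i => (val z i).2) \in (X : set (full_shift Sigma)).
Proof. by apply/mem_set; have /ext_pointP[] := set_mem (valP z). Qed.

Definition base (z : XG) : X := SigSub (base_in z).

Definition fiber (z : XG) : G := (val z 0%R).1.

Definition lift_point (g : G) (x : full_shift Sigma) :
  full_shift (G * Sigma)%type := fun i => ((g * cocycle x i)%g, x i).

Lemma lift_in g (x : X) : lift_point g (val x) \in (XG : set (full_shift _)).
Proof.
apply/mem_set/ext_pointP; split; first exact: set_mem (valP x).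
by move=> i; rewrite /= cocycleS mulgA.
Qed.

Definition lift g x : XG := SigSub (lift_in g x).

Lemma lift_base g x : base (lift g x) = x.
Proof. exact: val_inj. Qed.

Lemma lift_fiber g x : fiber (lift g x) = g.
Proof. by rewrite /fiber /= mulg1. Qed.

(** [fiber] and [base] are coordinates on the extension: the base fixes all increments of the group
    components and the fiber fixes their value at 0. *)
Lemma ext_point_eq (y z : XG) : fiber y = fiber z -> base y = base z -> y = z.
Proof.
have /ext_pointP[_ yS] := set_mem (valP y).
have /ext_pointP[_ zS] := set_mem (valP z).
move=> fyz byz.
have b2 i : (val y i).2 = (val z i).2 by have := congr1 (fun x => val x i) byz.
apply: val_inj; apply/funext => i.
rewrite [LHS]surjective_pairing [RHS]surjective_pairing; apply: pair_eq => //.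
apply: (skew_unique (c := fun i => ell (val y i).2)
  (a := fun i => (val y i).1) (b := fun i => (val z i).1)) => // j.
by rewrite zS b2.
Qed.

Lemma liftK z : lift (fiber z) (base z) = z.
Proof. by apply: ext_point_eq; rewrite ?lift_fiber ?lift_base. Qed.

Lemma base_shift z : base (shift_on z) = shift_on (base z).
Proof. exact: val_inj. Qed.

Lemma fiber_shift z : fiber (shift_on z) = (fiber z * tau ell (base z))%g.
Proof. by have /ext_pointP[_ zS] := set_mem (valP z); rewrite /fiber -zS. Qed.

Lemma lift_shift g x :
  shift_on (lift g x) = lift (g * tau ell x)%g (shift_on x).
Proof.
apply: ext_point_eq; last by rewrite base_shift !lift_base.
by rewrite fiber_shift !lift_fiber lift_base.
Qed.

Lemma base_translate g z : base (translate_on g z) = base z.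
Proof. exact: val_inj. Qed.

Lemma fiber_translate g z : fiber (translate_on g z) = (g * fiber z)%g.
Proof. by []. Qed.

Lemma lift_translate g h x : translate_on g (lift h x) = lift (g * h)%g x.
Proof.
apply: ext_point_eq; last by rewrite base_translate !lift_base.
by rewrite fiber_translate !lift_fiber.
Qed.

Lemma base_continuous : continuous base.
Proof.
apply/continuous_subshift => i z; exists `|i|%N => y zy.
by rewrite /= (zy i).
Qed.

Lemma fiber_continuous : continuous (fiber : XG -> discrete_topology G).
Proof.
by apply/continuous_local => z; exists 0%N => y zy; rewrite /fiber (zy 0%R).
Qed.

Lemma lift_continuous (Sigma' : finType) (Y : subshift Sigma')
    (h : Y -> discrete_topology G) (f : Y -> X) :
  continuous h -> continuous f -> continuous (fun y => lift (h y) (f y)).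
Proof.
move=> /continuous_local lh cf; apply/continuous_subshift => i.
(* The cocycle at [i] reads only coordinates of absolute value at most [|i|]. *)
have lc : local (fun y => (cocycle (val (f y)) i, val (f y) i)).
  move=> y; have : nbhs (f y) [set x : X | agree `|i|%N (val (f y)) (val x)]%classic.
    by apply/nbhs_subshift; exists `|i|%N.
  move=> /cf/nbhs_subshift[k kf]; exists k => y' /kf /= ff'.
  by rewrite (cocycle_agree (leqnn _) ff') (ff' i).
exact: (local_map2 (fun g p => ((g * p.1)%g, p.2)) lh lc).
Qed.

End ExtensionPoints.

Section ExtensionConjugacy.
Variables (G : finGroupType) (Sigma Sigma' : finType).
Variables (L : lambda_graph Sigma) (L' : lambda_graph Sigma').
Variables (ell : Sigma -> G) (ell' : Sigma' -> G).

(** The map (g, x) |-> (g u(x), f(x)) multiplies on the right and so commutes with left translation;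
    its compatibility with the shift is exactly the cohomology equation. *)
Lemma weight_gconjugate :
  weight_conjugate (presented L) (presented L') ell ell' ->
  gconjugate (extension_gsubshift L ell) (extension_gsubshift L' ell').
Proof.
move=> [f [[[cf [f' [fK f'K cf']]] fs] [u [cu ue]]]].
pose F (z : presented (extension L ell)) : presented (extension L' ell') :=
  lift ell' (fiber z * (u (base z) : G))%g (f (base z)).
pose F' (z : presented (extension L' ell')) : presented (extension L ell) :=
  lift ell (fiber z * (u (f' (base z)) : G)^-1)%g (f' (base z)).
have cbase := @base_continuous G Sigma L ell.
have cbase' := @base_continuous G Sigma' L' ell'.
exists F; split; last first.
  move=> g z; change (F (translate_on g z) = translate_on g (F z)).
  rewrite /F lift_translate base_translate.
  by rewrite fiber_translate mulgA.
split; last first.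
  move=> z; apply: ext_point_eq; last by rewrite base_shift !lift_base base_shift fs.
  rewrite fiber_shift !lift_fiber lift_base fiber_shift base_shift.
  by rewrite ue /= !mulgA mulgKV.
split.
  apply: lift_continuous; last by move=> z; exact: continuous_comp (cbase z) (cf _).
  apply/continuous_local; apply: local_map2.
    exact/continuous_local/fiber_continuous.
  by apply/continuous_local => z; exact: continuous_comp (cbase z) (cu _).
exists F'; split.
- move=> z; apply: ext_point_eq; last by rewrite !lift_base fK.
  by rewrite /F' /F !(lift_fiber, lift_base) fK mulgK.
- move=> z; apply: ext_point_eq; last by rewrite !lift_base f'K.
  by rewrite /F' /F !(lift_fiber, lift_base) mulgKV.
- have cf'b : continuous (f' \o @base G Sigma' L' ell').
    by move=> z; exact: continuous_comp (cbase' z) (cf' _).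
  apply: lift_continuous => //.
  apply/continuous_local; apply: local_map2.
    exact/continuous_local/fiber_continuous.
  (* Inversion takes one argument; a constant function fills the second slot. *)
  apply: (local_map2 (fun (g : G) (_ : unit) => g^-1%g) _ (g := fun=> tt)).
    by apply/continuous_local => z; exact: continuous_comp (cf'b z) (cu _).
  by move=> z; exists 0%N.
Qed.

End ExtensionConjugacy.

Section ExtensionConjugacyConverse.
Variable G : finGroupType.

(** Resetting the fiber of [F (1, x)] to 1 is a translation. It passes through the equivariant maps
    and leaves the base unchanged. *)
Lemma base_lift_cancel (Sigma Sigma' : finType) (L : lambda_graph Sigma)
    (L' : lambda_graph Sigma') (ell : Sigma -> G) (ell' : Sigma' -> G)
    (F : presented (extension L ell) -> presented (extension L' ell'))
    (F' : presented (extension L' ell') -> presented (extension L ell)) x :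
  cancel F F' -> (forall g z, F (translate_on g z) = translate_on g (F z)) ->
  base (F' (lift ell' 1 (base (F (lift ell 1 x))))) = x.
Proof.
move=> FK Ft; set z := F _.
have -> : lift ell' 1 (base z) = translate_on (fiber z)^-1%g z.
  by rewrite -[in RHS](liftK z) lift_translate lift_fiber mulVg.
by rewrite -Ft FK base_translate lift_base.
Qed.

Lemma gconjugate_weight (Sigma Sigma' : finType) (L : lambda_graph Sigma)
    (L' : lambda_graph Sigma') (ell : Sigma -> G) (ell' : Sigma' -> G) :
  gconjugate (extension_gsubshift L ell) (extension_gsubshift L' ell') ->
  weight_conjugate (presented L) (presented L') ell ell'.
Proof.
move=> [F [[[cF [F' [FK F'K cF']]] Fs] Ft]].
have {}Ft g z : F (translate_on g z) = translate_on g (F z) := Ft g z.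
have F't g z : F' (translate_on g z) = translate_on g (F' z).
  by apply: (can_inj FK); rewrite F'K Ft F'K.
have clift (S : finType) (M : lambda_graph S) (m : S -> G) :
    continuous (@lift G S M m 1%g).
  apply: (@lift_continuous _ _ _ _ _ _ (fun=> 1%g) id) => // [|x].
    exact: cst_continuous.
  exact: cvg_id.
have cFl : continuous (F \o lift ell 1%g).
  by move=> x; exact: continuous_comp (clift _ _ _ x) (cF _).
have cF'l : continuous (F' \o lift ell' 1%g).
  by move=> x; exact: continuous_comp (clift _ _ _ x) (cF' _).
(* The shift of (1, x) is (tau x, shift x), the translate by [tau x] of the lift sought. Comparing
   fibers makes [fiber (F (1, x))] a transfer function. *)
have FS x : F (lift ell 1%g (shift_on x)) =
    translate_on (tau ell x)^-1%g (shift_on (F (lift ell 1%g x))).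
  by rewrite -Fs lift_shift mul1g -Ft lift_translate mulVg.
exists (fun x => base (F (lift ell 1%g x))); split.
  split; last by move=> x; rewrite FS base_translate base_shift.
  split.
    by move=> x; exact: continuous_comp (cFl x) (@base_continuous _ _ _ _ _).
  exists (fun x => base (F' (lift ell' 1%g x))); split.
  - by move=> x; exact: base_lift_cancel FK Ft.
  - by move=> x; exact: base_lift_cancel F'K F't.
  - by move=> x; exact: continuous_comp (cF'l x) (@base_continuous _ _ _ _ _).
exists (fun x => fiber (F (lift ell 1%g x))); split.
  by move=> x; exact: continuous_comp (cFl x) (@fiber_continuous _ _ _ _ _).
move=> x; rewrite FS fiber_translate fiber_shift /=.
by rewrite !invMg invgK !mulgA mulgK mulgV mul1g.
Qed.

End ExtensionConjugacyConverse.

(** * Canonical symbolic matrix systems *)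

Section IndicatorMatrices.
Variable Z : Type.

(** Every [z] acts as an edge from [f z] to [g z] labeled [e z]; edges with equal ends and labels
    count once. *)
Definition sym_mx (E : finType) m n (f : Z -> 'I_m) (e : Z -> E) (g : Z -> 'I_n) :
  'M[formal_sum E]_(m, n) :=
  \matrix_(i, j) [ffun a => `[<exists z, [/\ f z = i, e z = a & g z = j]>] : nat].

Definition inc_mx m n (f : Z -> 'I_m) (g : Z -> 'I_n) : 'M[nat]_(m, n) :=
  \matrix_(i, j) (`[<exists z, f z = i /\ g z = j>] : nat).

Lemma asbool_eq1 (P : Prop) : (`[<P>] : nat) = 1%N <-> P.
Proof. by case: asboolP. Qed.

Lemma asbool_iff (P Q : Prop) : (P <-> Q) -> `[<P>] = `[<Q>] :> nat.
Proof. by move=> PQ; congr nat_of_bool; exact: asbool_equiv_eq. Qed.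

(** Uniqueness leaves at most one nonzero summand, so products of indicator matrices are again
    indicator matrices. *)
Lemma sum_asbool (I : finType) (P Q : I -> Prop) :
  (forall i j, P i -> Q i -> P j -> Q j -> i = j) ->
  (\sum_i `[<P i>] * `[<Q i>])%N = `[<exists i, P i /\ Q i>].
Proof.
move=> PQ1; case: asboolP => [[i [Pi Qi]]|nPQ].
  rewrite (bigD1 i) //= (asboolT Pi) (asboolT Qi) big1 // => j ji.
  case: asboolP => // Pj; case: asboolP => // Qj.
  by rewrite (PQ1 j i) ?eqxx in ji.
rewrite big1 // => i _; case: asboolP => // Pi; case: asboolP => // Qi.
by case: nPQ; exists i.
Qed.

Lemma sym_mx_ext (E : finType) m n f f' (e e' : Z -> E) (g g' : Z -> 'I_n) :
  f =1 f' -> e =1 e' -> g =1 g' -> @sym_mx E m n f e g = sym_mx f' e' g'.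
Proof. by move=> /funext-> /funext-> /funext->. Qed.

Lemma sym_mx_cast (E : finType) m n m' n' (em : m = m') (en : n = n')
    (f : Z -> 'I_m) (e : Z -> E) (g : Z -> 'I_n) :
  castmx (em, en) (sym_mx f e g) = sym_mx (cast_ord em \o f) e (cast_ord en \o g).
Proof.
subst m' n'; rewrite castmx_id.
by apply: sym_mx_ext => // z; rewrite /= cast_ord_id.
Qed.

Lemma inc_mx_cast m n m' n' (em : m = m') (en : n = n')
    (f : Z -> 'I_m) (g : Z -> 'I_n) :
  castmx (em, en) (inc_mx f g) = inc_mx (cast_ord em \o f) (cast_ord en \o g).
Proof.
subst m' n'; rewrite castmx_id; congr inc_mx.
  by apply/funext => z; rewrite /= cast_ord_id.
by apply/funext => z; rewrite /= cast_ord_id.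
Qed.

Lemma sym_mx_substitute (E F : finType) (phi : E -> F) m n (f : Z -> 'I_m)
    (e : Z -> E) (g : Z -> 'I_n) :
  injective phi -> map_mx (substitute phi) (sym_mx f e g) = sym_mx f (phi \o e) g.
Proof.
move=> phiI; apply/matrixP => i j; apply/ffunP => b; rewrite !mxE !ffunE.
rewrite big_mkcond /=.
transitivity (\sum_a `[<phi a = b>] *
    `[<exists z, [/\ f z = i, e z = a & g z = j]>])%N.
  apply: eq_bigr => a _; rewrite ffunE; case: eqP => ab.
    by rewrite (asboolT ab) mul1n.
  by case: asboolP.
rewrite sum_asbool; last by move=> a a' <- _ /phiI.
apply: asbool_iff; split=> [[a [<- [z [fz <- gz]]]]|[z [fz <- gz]]].
  by exists z.
by exists (e z); split=> //; exists z.
Qed.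

(** The first hypothesis, a left-resolving condition, makes the middle vertex of a path unique. The
    second replaces two edges meeting at a vertex by consecutive edges on the orbit of one point. *)
Lemma sym_mx_comp (E F : finType) m n p (f : Z -> 'I_m) (g : Z -> 'I_n)
    (h : Z -> 'I_p) (e : Z -> E) (e' : Z -> F) (t t' : Z -> Z) :
  (forall z z', e' z = e' z' -> h (t' z) = h (t' z') -> g z = g z') ->
  (forall z z', g (t z) = g z' -> exists y,
    [/\ e y = e z, f y = f z, e' (t y) = e' z' & h (t' (t y)) = h (t' z')]) ->
  symbolic_mul (sym_mx f e (g \o t)) (sym_mx g e' (h \o t')) =
  sym_mx f (fun z => (e z, e' (t z))) (h \o t' \o t).
Proof.
move=> det lift; apply/matrixP => i j; apply/ffunP => -[a b].
rewrite symbolic_mulE !mxE ffunE /=.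
under eq_bigr do rewrite !mxE !ffunE.
rewrite sum_asbool.
  apply: asbool_iff; split.
    move=> [k [[z [<- <- zk]] [z' [zk' <- <-]]]].
    have [|y [ey fy e'y hy]] := lift z z'; first by rewrite zk' -zk.
    by exists y; rewrite fy ey e'y.
  move=> [z [fz [<- <-] hz]]; exists (g (t z)).
  by split; [exists z | exists (t z)].
by move=> k k' _ [z [<- zb zj]] _ [z' [<- zb' zj']]; apply: det;
  [rewrite zb | rewrite [LHS]zj].
Qed.

Lemma inc_mx_comp m n p (f : Z -> 'I_m) (g : Z -> 'I_n) (h : Z -> 'I_p) :
  (forall z z', g z = g z' -> f z = f z') ->
  (forall z z', h z = h z' -> g z = g z') ->
  (inc_mx f g *m inc_mx g h)%R = inc_mx f h.
Proof.
move=> gf hg; apply/matrixP => i j; rewrite nat_mulmxE !mxE.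
under eq_bigr do rewrite !mxE.
rewrite sum_asbool.
  apply: asbool_iff; split.
    move=> [k [[z [<- zk]] [z' [zk' <-]]]]; exists z'; split=> //.
    by apply: gf; rewrite zk.
  by move=> [z [fz hz]]; exists (g z); split; exists z.
move=> k k' _ [z [<- zj]] _ [z' [<- zj']]; apply: hg; congruence.
Qed.

(** The local property for classes. Going left to right only weakens the classes; the converse needs
    the lifting hypothesis. On each side the middle index is unique. *)
Lemma sym_inc_comm (E : finType) m m' n n' (f : Z -> 'I_m) (f' : Z -> 'I_m')
    (g : Z -> 'I_n) (g' : Z -> 'I_n') (e : Z -> E) (t : Z -> Z) :
  (forall z z', f' z = f' z' -> f z = f z') ->
  (forall z z', g' z = g' z' -> g z = g z') ->
  (forall z z', e z = e z' -> g' (t z) = g' (t z') -> f' z = f' z') ->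
  (forall z z', g (t z) = g z' -> exists y,
    [/\ e y = e z, f y = f z & g' (t y) = g' z']) ->
  symbolic_mull (inc_mx f f') (sym_mx f' e (g' \o t)) =
  symbolic_mulr (sym_mx f e (g \o t)) (inc_mx g g').
Proof.
move=> ff' gg' det lift; apply/matrixP => i j; apply/ffunP => a.
rewrite symbolic_mullE symbolic_mulrE.
under eq_bigr do rewrite !mxE !ffunE.
under [RHS]eq_bigr do rewrite !mxE !ffunE.
rewrite !sum_asbool.
- apply: asbool_iff; split.
    move=> [k [[z [<- zk]] [z' [zk' <- <-]]]]; exists (g (t z')).
    split; last by exists (t z').
    by exists z'; split=> //; apply: ff'; rewrite zk.
  move=> [k [[z [<- <- zk]] [z' [zk' <-]]]].
  have [|y [ey fy gy]] := lift z z'; first by rewrite zk' -zk.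
  by exists (f' y); split; exists y.
- by move=> k k' _ [z [<- zj]] _ [z' [<- zj']]; apply: gg'; congruence.
- by move=> k k' _ [z [<- za zj]] _ [z' [<- za' zj']]; apply: det;
    [rewrite za | rewrite [LHS]zj].
Qed.

End IndicatorMatrices.

(** * Classes of points with the same past words *)

Section PastEquivalence.
Variables (Z : Type) (T : Z -> Z) (A : finType) (s : Z -> A).

Definition itinerary (z : Z) : nat -> A := fun k => s (iter k T z).

Lemma itinerary_cons z z' :
  itinerary z = itinerary z' <->
  s z = s z' /\ itinerary (T z) = itinerary (T z').
Proof.
split=> [zz'|[sz zz']].
  split; first exact: (congr1 (fun f => f 0%N) zz').
  by apply/funext => k; have := congr1 (fun f => f k.+1) zz'; rewrite /itinerary !iterSr.
apply/funext => -[|k] //; have := congr1 (fun f => f k) zz'.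
by rewrite /itinerary -!iterSr.
Qed.

(** One backward refinement of the partition [f]. Predecessors of all points sharing the itinerary
    of [z] are collected, so the value depends on that itinerary alone. *)
Definition past_step (V : finType) (f : Z -> V) (z : Z) : {set A * V} :=
  [set p | `[<exists y, itinerary (T y) = itinerary z /\ p = (s y, f y)>]].

Definition past_sim (V : Type) (f : Z -> V) z z' := forall y,
  itinerary (T y) = itinerary z ->
  exists y', [/\ s y' = s y, itinerary (T y') = itinerary z' & f y' = f y].

Lemma past_stepP (V : finType) (f : Z -> V) z z' :
  past_step f z = past_step f z' <-> past_sim f z z' /\ past_sim f z' z.
Proof.
have sim u u' : past_step f u = past_step f u' -> past_sim f u u'.
  move=> /setP uu' y yu.
  have := uu' (s y, f y); rewrite !inE.
  rewrite asboolT; last by exists y.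
  by move=> /esym/asboolP[y' [y'u [sy fy]]]; exists y'.
split=> [zz'|[zz' z'z]]; first by split; apply: sim.
apply/setP => p; rewrite !inE; apply/asboolP/asboolP => -[y [yz ->]].
  by have [y' [sy y'z fy]] := zz' y yz; exists y'; rewrite sy fy.
by have [y' [sy y'z fy]] := z'z y yz; exists y'; rewrite sy fy.
Qed.

(** Iterated power sets keep the codes in finite types, so each level has finitely many classes. *)
Fixpoint past_type (l : nat) : finType :=
  if l is m.+1 then {set (A * past_type m)%type} else unit.

(* Two points have the same value under [past_code l] iff the right-infinite
   sequences which they define have the same past words of length [l]. *)
Fixpoint past_code (l : nat) : Z -> past_type l :=
  if l is m.+1 return Z -> past_type l then past_step (@past_code m)
  else fun=> tt.

Lemma past_codeP l z z' : past_code l.+1 z = past_code l.+1 z' <->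
  past_sim (past_code l) z z' /\ past_sim (past_code l) z' z.
Proof. exact: past_stepP. Qed.

Lemma itinerary_past l z z' :
  itinerary z = itinerary z' -> past_code l z = past_code l z'.
Proof. by case: l => //= l zz'; rewrite /past_step zz'. Qed.

Lemma past_codeS l z z' :
  past_code l.+1 z = past_code l.+1 z' -> past_code l z = past_code l z'.
Proof.
elim: l z z' => // l IH z z' /past_codeP[zz' z'z].
by apply/past_codeP; split=> y yz; [have [y' [sy y'z /IH cy]] := zz' y yz |
  have [y' [sy y'z /IH cy]] := z'z y yz]; exists y'.
Qed.

(** The left-resolving property. The simulation answers the predecessor [z] of [T z] by a point over
    [T z'] with the same symbol, hence with the itinerary of [z']. *)
Lemma past_code_cons l z z' : s z = s z' ->
  past_code l.+1 (T z) = past_code l.+1 (T z') -> past_code l z = past_code l z'.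
Proof.
move=> sz /past_codeP[zz' _]; have [y [sy yz' <-]] := zz' z erefl.
by apply: itinerary_past; apply/itinerary_cons; rewrite sy sz.
Qed.

(** This provides the lifting hypotheses of [sym_mx_comp] and [sym_inc_comm]. *)
Lemma past_code_lift l z z' : past_code l.+1 (T z) = past_code l.+1 z' ->
  exists y, [/\ s y = s z, itinerary (T y) = itinerary z' &
                past_code l y = past_code l z].
Proof. by move=> /past_codeP[zz' _]; exact: zz'. Qed.

End PastEquivalence.

Section CanonicalPresentation.
Variables (Z : Type) (T : Z -> Z).

Definition quotient_map (V : Type) (f : Z -> V) n (q : Z -> 'I_n) : Prop :=
  (forall i, exists z, q z = i) /\ forall z z', q z = q z' <-> f z = f z'.

Lemma quotient_map_exists (V : finType) (f : Z -> V) :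
  exists n (q : Z -> 'I_n), quotient_map f q.
Proof.
pose I : finType := {v : V | `[<exists z, f z = v>]}.
have fI z : `[<exists z', f z' = f z>] by apply/asboolP; exists z.
exists #|I|, (fun z => enum_rank (exist _ (f z) (fI z) : I)); split.
  move=> i; have /asboolP[z zi] := valP (enum_val i).
  by exists z; rewrite -[RHS]enum_valK; congr enum_rank; exact: val_inj.
move=> z z'; split=> [/enum_rank_inj/(congr1 val)|zz'] //.
by congr enum_rank; apply: val_inj.
Qed.

Lemma quotient_map_leq (V W : Type) (f : Z -> V) (g : Z -> W) m n
    (p : Z -> 'I_m) (q : Z -> 'I_n) :
  quotient_map f p -> quotient_map g q ->
  (forall z z', g z = g z' -> f z = f z') -> (m <= n)%N.
Proof.
move=> [ps pf] [_ qg] gf; have [h hP] := choice ps.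
have hI : injective (q \o h).
  by move=> i j /= /qg/gf/pf; rewrite !hP.
by have := leq_card _ hI; rewrite !card_ord.
Qed.

(** The canonical system of the subshift of itineraries of [s]: the edge of [z] joins the class of
    [z] to that of [T z]. The numberings [q] are arbitrary. *)
Definition canonical_presentation (A : finType) (s : Z -> A)
    (S : symbolic_system A) : Prop :=
  exists q : forall l, Z -> 'I_(dim S l),
    [/\ forall l, quotient_map (past_code T s l) (q l),
        forall l, Mx S l = sym_mx (q l) s (q l.+1 \o T) &
        forall l, Ix S l = inc_mx (q l) (q l.+1)].

Hypothesis T_surj : forall z, exists y, T y = z.

Lemma canonical_presentation_exists (A : finType) (s : Z -> A) :
  exists S : symbolic_system A, canonical_presentation s S.
Proof.
have QE l : exists Q : {n & Z -> 'I_n},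
    quotient_map (past_code T s l) (projT2 Q).
  have [n [q qP]] := quotient_map_exists (past_code T s l).
  by exists (existT _ n q).
have [n [q qP]] : exists n (q : forall l, Z -> 'I_(n l)),
    forall l, quotient_map (past_code T s l) (q l).
  have [Q QP] := choice QE.
  by exists (fun l => projT1 (Q l)), (fun l => projT2 (Q l)).
have qE l z z' : q l z = q l z' <-> past_code T s l z = past_code T s l z'.
  exact: (qP l).2.
have qS l i : exists z, q l z = i by exact: (qP l).1.
have Mnz l : no_zero_line (sym_mx (q l) s (q l.+1 \o T)).
  have nz i j a : (exists z, [/\ q l z = i, s z = a & (q l.+1 \o T) z = j]) ->
      sym_mx (q l) s (q l.+1 \o T) i j <> 0%R.
    by move=> ex /ffunP/(_ a); rewrite mxE !ffunE asboolT.
  split=> [i|j].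
    have [z zi] := qS l i; exists (q l.+1 (T z)).
    by apply: (nz _ _ (s z)); exists z.
  have [z zj] := qS l.+1 j; have [y yz] := T_surj z; exists (q l y).
  by apply: (nz _ _ (s y)); exists y; rewrite /= yz.
have I01 l : zero_one (inc_mx (q l) (q l.+1)).
  by move=> i j; rewrite mxE; case: asboolP; [right | left].
have Inz l : no_zero_line (inc_mx (q l) (q l.+1)).
  split=> [i|j].
    have [z zi] := qS l i; exists (q l.+1 z).
    by rewrite mxE asboolT //; exists z.
  have [z zj] := qS l.+1 j; exists (q l z).
  by rewrite mxE asboolT //; exists z.
have Icol l j : exists! i, inc_mx (q l) (q l.+1) i j = 1%N.
  have [z zj] := qS l.+1 j; exists (q l z); split.
    by rewrite mxE asboolT //; exists z.
  move=> i; rewrite mxE => /asbool_eq1[z' [<- z'j]].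
  by apply/qE/past_codeS/qE; rewrite zj z'j.
have comm l : symbolic_mull (inc_mx (q l) (q l.+1))
    (sym_mx (q l.+1) s (q l.+2 \o T)) =
    symbolic_mulr (sym_mx (q l) s (q l.+1 \o T)) (inc_mx (q l.+1) (q l.+2)).
  apply: sym_inc_comm.
  - by move=> z z' /qE zz'; apply/qE; exact: past_codeS.
  - by move=> z z' /qE zz'; apply/qE; exact: past_codeS.
  - by move=> z z' sz /qE zz'; apply/qE; exact: past_code_cons sz zz'.
  - move=> z z' /qE zz'; have [y [sy yz' cy]] := past_code_lift zz'.
    exists y; split=> //.
      exact/qE.
    by apply/qE; exact: itinerary_past.
by exists (SymbolicSystem Mnz I01 Inz Icol comm), q.
Qed.

End CanonicalPresentation.

(** * Pasts of a map compared with pasts of its square *)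

Section TwoStepPast.
Variables (Y : Type) (U : Y -> Y) (B : finType) (r : Y -> B).
Hypothesis U_surj : forall y, exists x, U x = y.

Definition past_sim2 (V : Type) (g : Y -> V) y y' := forall x,
  itinerary U r (U (U x)) = itinerary U r y ->
  exists x', [/\ r x' = r x, r (U x') = r (U x),
    itinerary U r (U (U x')) = itinerary U r y' & g x' = g x].

(** Two successive one-step refinements carry the same information as a single two-step one. *)
Lemma past_code2P l y y' :
  past_code U r l.+2 y = past_code U r l.+2 y' <->
  past_sim2 (past_code U r l) y y' /\ past_sim2 (past_code U r l) y' y.
Proof.
have sim u u' : past_sim U r (past_code U r l.+1) u u' ->
    past_sim2 (past_code U r l) u u'.
  move=> uu' x xu; have [v [rv vu' /past_codeP[_ vx]]] := uu' (U x) xu.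
  have [x' [rx x'v cx]] := vx x erefl; exists x'.
  by move: x'v => /itinerary_cons[rUx UUx]; rewrite rUx rv UUx vu'.
have sim2 u u' : past_sim2 (past_code U r l) u u' ->
    past_sim2 (past_code U r l) u' u -> past_sim U r (past_code U r l.+1) u u'.
  (* A predecessor [x] of [v] turns the one-step question into a two-step one; the answer [x']
     passes through the required point [U x']. *)
  move=> uu' u'u v vu; have [x xv] := U_surj v.
  have [|x' [rx rUx x'u' cx]] := uu' x; first by rewrite xv.
  exists (U x'); split=> //; first by rewrite rUx xv.
  (* Predecessors of [U x'] and of [v] are two-step predecessors of [u'] and [u]; the middle symbol
     being known, the two-step answers have the right itinerary. *)
  apply/past_codeP; split=> w /itinerary_cons[rw Uw].
    have [|w' [rw' rUw w'u cw]] := u'u w; first by rewrite Uw.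
    exists w'; split=> //; apply/itinerary_cons.
    by rewrite rUw rw rUx xv w'u vu.
  have [|w' [rw' rUw w'u cw]] := uu' w; first by rewrite Uw.
  exists w'; split=> //; apply/itinerary_cons.
  by rewrite rUw rw rUx xv w'u x'u'.
split=> [/past_codeP[yy' y'y]|[yy' y'y]]; first by split; apply: sim.
by apply/past_codeP; split; apply: sim2.
Qed.

Variables (Z : Type) (T : Z -> Z) (A : finType) (s : Z -> A) (f : Z -> Y).
Hypothesis fT : forall z, U (U (f z)) = f (T z).
Hypothesis fs : forall z z', s z = s z' <->
  r (f z) = r (f z') /\ r (U (f z)) = r (U (f z')).
Hypothesis f_closed : forall y z,
  itinerary U r (U (U y)) = itinerary U r (f z) -> exists z', y = f z'.

Lemma two_step_itinerary z z' :
  itinerary U r (f z) = itinerary U r (f z') <->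
  itinerary T s z = itinerary T s z'.
Proof.
have f_iter k u : iter k.*2 U (f u) = f (iter k T u).
  by elim: k => //= k ->; rewrite fT.
split=> zz'; apply/funext => k.
  have := congr1 (fun g => g k.*2) zz'; have := congr1 (fun g => g k.*2.+1) zz'.
  by rewrite /itinerary /= !f_iter => r1 r0; apply/fs.
have := congr1 (fun g => g k./2) zz'; rewrite /itinerary => /fs[r0 r1].
have kE u : iter k U (f u) = iter (odd k) U (f (iter k./2 T u)).
  by rewrite -{1}[k]odd_double_half iterD f_iter.
by rewrite !kE; case: (odd k).
Qed.

(** By [f_closed], two-step predecessors of points of the image of [f] stay in that image, so
    two-step simulations for [U] are simulations for [T]. *)
Lemma two_step_past l z z' :
  past_code U r l.*2 (f z) = past_code U r l.*2 (f z') <->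
  past_code T s l z = past_code T s l z'.
Proof.
elim: l z z' => // l IH z z'.
have sim u u' : past_sim2 (past_code U r l.*2) (f u) (f u') <->
    past_sim T s (past_code T s l) u u'.
  split=> uu' y.
    move=> yu; have [|x' [rx rUx x'u' cx]] := uu' (f y).
      by rewrite fT; apply/two_step_itinerary.
    have [y' y'E] := f_closed x'u'; rewrite y'E fT in rx rUx x'u' cx.
    exists y'; split; [exact/fs | exact/two_step_itinerary | exact/IH].
  move=> yu; have [y1 y1E] := f_closed yu; rewrite y1E fT in yu *.
  move: yu => /two_step_itinerary/uu'[y' [/fs[rx rUx] y'u' cy]].
  exists (f y'); split=> //; last exact/IH.
  by rewrite fT; apply/two_step_itinerary.
rewrite (past_codeP T s l) (past_code2P l.*2).
by rewrite !sim.
Qed.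

End TwoStepPast.

Section Bipartite.
Variables (Z : Type) (T : Z -> Z) (C D : finType) (c : Z -> C) (d : Z -> D).
Hypothesis T_surj : forall z, exists y, T y = z.

(* [(z, false)] reads the sequence c(z) d(z) c(Tz) ... and [(z, true)] reads
   d(z) c(Tz) d(Tz) ... *)
Definition half_map (y : Z * bool) : Z * bool :=
  if y.2 then (T y.1, false) else (y.1, true).

Definition half_symbol (y : Z * bool) : C + D :=
  if y.2 then inr (d y.1) else inl (c y.1).

Lemma half_map_surj y : exists x, half_map x = y.
Proof.
case: y => z [|]; first by exists (z, false).
by have [x <-] := T_surj z; exists (x, true).
Qed.

Definition half_past k (b : bool) (z : Z) :=
  past_code half_map half_symbol k (z, b).

Variables (A : finType) (s : Z -> A).

(** Two half steps make one step of [T] and read one symbol of [s]. The tags of [C + D] separate the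
    phases, which gives the closure condition of [two_step_past]. *)
Lemma half_past_even (phi : A -> C * D) :
  injective phi -> (forall z, phi (s z) = (c z, d z)) ->
  forall l z z', half_past l.*2 false z = half_past l.*2 false z' <->
    past_code T s l z = past_code T s l z'.
Proof.
move=> phiI phiE l z z'.
apply: (@two_step_past _ half_map _ _ half_map_surj _ _ _ _ (fun z => (z, false))).
- by [].
- move=> u u'; rewrite /half_symbol /half_map /=; split.
    by move=> /(congr1 phi); rewrite !phiE => -[-> ->].
  by move=> [[cu] [du]]; apply: phiI; rewrite !phiE cu du.
- move=> [y [|]] u /(congr1 (fun g => g 0%N)) //=.
  by exists y.
Qed.

Lemma half_past_even' (phi : A -> D * C) :
  injective phi -> (forall z, phi (s z) = (d z, c (T z))) ->
  forall l z z', half_past l.*2 true z = half_past l.*2 true z' <->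
    past_code T s l z = past_code T s l z'.
Proof.
move=> phiI phiE l z z'.
apply: (@two_step_past _ half_map _ _ half_map_surj _ _ _ _ (fun z => (z, true))).
- by [].
- move=> u u'; rewrite /half_symbol /half_map /=; split.
    by move=> /(congr1 phi); rewrite !phiE => -[-> ->].
  by move=> [[cu] [du]]; apply: phiI; rewrite !phiE cu du.
- move=> [y [|]] u /(congr1 (fun g => g 0%N)) //=.
  by exists y.
Qed.

End Bipartite.

(** * Bipartite presentations *)

Section LevelFamily.
Variables (Z : Type) (V : nat -> Type) (f : forall k, Z -> V k).
Variables (m : nat -> nat) (q : forall l, Z -> 'I_(m l)).

Lemma cast_existT (u v : {n & Z -> 'I_n}) (uv : u = v) z :
  cast_ord (congr1 (@projT1 _ _) uv) (projT2 u z) = projT2 v z.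
Proof. by case: v / uv; apply: val_inj. Qed.

(** Even levels must carry the prescribed numberings, odd levels any. Packing a dimension with its
    map permits a choice by parity; the dimensions at even levels then agree only through a proof,
    hence [cast_ord]. *)
Lemma level_family :
  (forall l, quotient_map (f l.*2) (q l)) ->
  (forall k, exists n (p : Z -> 'I_n), quotient_map (f k) p) ->
  exists (n : nat -> nat) (p : forall k, Z -> 'I_(n k)) (nm : forall l, n l.*2 = m l),
    (forall l, cast_ord (nm l) \o p l.*2 = q l) /\
    (forall k, quotient_map (f k) (p k)).
Proof.
move=> qP ex.
have exT k : exists P : {n & Z -> 'I_n}, quotient_map (f k) (projT2 P).
  by have [n [p pP]] := ex k; exists (existT _ n p).
have [P PP] := choice exT.
pose pack k : {n & Z -> 'I_n} := if odd k then P k else existT _ (m k./2) (q k./2).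
have packE l : pack l.*2 = existT _ (m l) (q l).
  by rewrite /pack odd_double doubleK.
exists (fun k => projT1 (pack k)), (fun k => projT2 (pack k)),
  (fun l => congr1 (@projT1 _ _) (packE l)); split.
  by move=> l; apply/funext => z; exact: (cast_existT (packE l) z).
move=> k; rewrite /pack; case: ifPn => [_|even_k]; first exact: PP.
by have := qP k./2; rewrite even_halfK.
Qed.

End LevelFamily.

(** * Weights and the semigroup ring *)

Section GroupMatrices.
Variable G : finGroupType.

Lemma substitute_comp (A B C : finType) (f : A -> B) (g : B -> C) (a : formal_sum A) :
  substitute g (substitute f a) = substitute (g \o f) a.
Proof.
apply/ffunP => t; rewrite !ffunE.
under eq_bigr do rewrite ffunE.
rewrite (exchange_big_dep (fun x => g (f x) == t)) /=; last first.
  by move=> b x gb /eqP->.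
apply: eq_bigr => x gfx; rewrite (big_pred1 (f x)) // => b /=.
by rewrite [f x == b]eq_sym; have [->|] := eqVneq b (f x); rewrite ?gfx ?andbF.
Qed.

(** The product of the semigroup ring is a convolution: sort the pairs by the value [h] of [f]; the
    second symbol must then have weight [h^-1 * t]. *)
Lemma substitute_pair_mul (C D : finType) (f : C -> G) (g : D -> G)
    (a : formal_sum C) (b : formal_sum D) :
  substitute (fun p => (f p.1 * g p.2)%g) (pair_mul a b) =
  ((substitute f a : semigroup_ring G) * (substitute g b : semigroup_ring G))%R.
Proof.
apply/ffunP => t; rewrite !ffunE /=.
under eq_bigr do rewrite ffunE.
rewrite -(pair_big_dep xpredT (fun x y => (f x * g y)%g == t)
  (fun x y => a x * b y)%N) /=.
transitivity (\sum_h \sum_(x | f x == h) \sum_(y | (f x * g y)%g == t) a x * b y)%N.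
  rewrite [RHS](exchange_big_dep xpredT) //=; apply: eq_bigr => x _.
  by rewrite (big_pred1 (f x)) // => h; rewrite eq_sym.
apply: eq_bigr => h _; rewrite !ffunE big_distrl /=.
apply: eq_bigr => x /eqP <-; rewrite big_distrr /=; apply: eq_bigl => y.
by apply/eqP/eqP => [<-|->]; rewrite ?mulKg ?mulKVg.
Qed.

Lemma substituteD (A B : finType) (f : A -> B) (I : finType)
    (F : I -> formal_sum A) :
  substitute f (\sum_i F i)%R = (\sum_i substitute f (F i))%R.
Proof.
apply/ffunP => t; rewrite ffunE sum_ffunE.
under eq_bigr do rewrite sum_ffunE.
rewrite exchange_big; apply: eq_bigr => i _; rewrite ffunE.
exact: eq_bigr.
Qed.

Lemma group_mx_mul (C D : finType) (f : C -> G) (g : D -> G) m n p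
    (P : 'M[formal_sum C]_(m, n)) (Q : 'M[formal_sum D]_(n, p)) :
  group_mx (fun cd => (f cd.1 * g cd.2)%g) (symbolic_mul P Q) =
  (group_mx f P *m group_mx g Q)%R.
Proof.
apply/matrixP => i j; rewrite !mxE substituteD; apply: eq_bigr => k _.
by rewrite !mxE substitute_pair_mul.
Qed.

(** Substituting weights into the symbolic factorization gives the one over the semigroup ring. *)
Lemma group_mx_factor (A C D : finType) (phi : A -> C * D) (ell : A -> G)
    (f : C -> G) (g : D -> G) m n m' n' p (em : m' = m) (en : n' = n)
    (M : 'M[formal_sum A]_(m, n)) (P : 'M[formal_sum C]_(m', p))
    (Q : 'M[formal_sum D]_(p, n')) :
  (forall a, ell a = (f (phi a).1 * g (phi a).2)%g) ->
  map_mx (substitute phi) M = castmx (em, en) (symbolic_mul P Q) ->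
  group_mx ell M = castmx (em, en) (group_mx f P *m group_mx g Q)%R.
Proof.
move=> ellE ME; rewrite -group_mx_mul -map_castmx -ME -map_mx_comp.
apply: eq_map_mx => a /=; rewrite substitute_comp.
by congr substitute; apply/funext.
Qed.

Lemma proper_gsse1_of_sse (A B : group_system G)
    (w : proper_sse1 (system A) (system B)) (ellC : sse_C w -> G)
    (ellD : sse_D w -> G) :
  (forall a, weight A a = (ellC (sse_spec w a).1 * ellD (sse_spec w a).2)%g) ->
  (forall b, weight B b = (ellD (sse_spec' w b).1 * ellC (sse_spec' w b).2)%g) ->
  proper_gsse1 A B.
Proof.
move=> wA wB; exists w, ellC, ellD; split=> // l.
  exact: group_mx_factor wA (sse_Mx_PQ w l).
exact: group_mx_factor wB (sse_Mx'_QP w l).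
Qed.

Lemma proper_gsse1_sym (A B : group_system G) :
  proper_gsse1 A B -> proper_gsse1 B A.
Proof. by move=> [w [f [g [wA wB MA MB]]]]; exists (sse_swap w), g, f. Qed.

Lemma proper_gsse_sym (A B : group_system G) :
  proper_gsse A B -> proper_gsse B A.
Proof.
elim=> {A B} [A B AB|A B C _ BA _ CB].
  exact/t_step/proper_gsse1_sym.
exact: t_trans CB BA.
Qed.

End GroupMatrices.

Section BipartiteEquivalence.
Variables (Z : Type) (T : Z -> Z) (C D : finType) (c : Z -> C) (d : Z -> D).
Hypothesis T_surj : forall z, exists y, T y = z.

Let past := half_past T c d.
Let itin := itinerary (half_map T) (half_symbol c d).

Lemma half_pastS k b z z' : past k.+1 b z = past k.+1 b z' -> past k b z = past k b z'.
Proof. exact: past_codeS. Qed.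

Lemma half_past_itinerary k b z z' :
  itin (z, b) = itin (z', b) -> past k b z = past k b z'.
Proof. exact: itinerary_past. Qed.

Lemma half_itinerary_cons z z' : itin (z, true) = itin (z', true) ->
  d z = d z' /\ itin (T z, false) = itin (T z', false).
Proof. by move=> /itinerary_cons[[dz] zz']. Qed.

Lemma half_itinerary_cons' z z' : itin (z, false) = itin (z', false) ->
  c z = c z' /\ itin (z, true) = itin (z', true).
Proof. by move=> /itinerary_cons[[cz] zz']. Qed.

Lemma half_past_cons k z z' : c z = c z' ->
  past k.+1 true z = past k.+1 true z' -> past k false z = past k false z'.
Proof.
move=> cz; apply: (@past_code_cons _ (half_map T) _ _ k (z, false) (z', false)).
by rewrite /half_symbol /= cz.
Qed.

Lemma half_past_cons' k z z' : d z = d z' ->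
  past k.+1 false (T z) = past k.+1 false (T z') -> past k true z = past k true z'.
Proof.
move=> dz; apply: (@past_code_cons _ (half_map T) _ _ k (z, true) (z', true)).
by rewrite /half_symbol /= dz.
Qed.

Lemma half_past_lift k z z' : past k.+1 true z = past k.+1 true z' ->
  exists y, [/\ c y = c z, itin (y, true) = itin (z', true) &
                past k false y = past k false z].
Proof.
move=> zz'.
(* The other phase is excluded, since its symbols lie in the other summand of [C + D]. *)
have [[y [|]] [//= [cy] yz' py]] :=
  @past_code_lift _ (half_map T) _ (half_symbol c d) k (z, false) (z', true) zz'.
by exists y.
Qed.

Lemma half_past_lift' k z z' : past k.+1 false (T z) = past k.+1 false z' ->
  exists y, [/\ d y = d z, itin (T y, false) = itin (z', false) &
                past k true y = past k true z].
Proof.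
move=> zz'.
have [[y [|]] [//= [cy] yz' py]] :=
  @past_code_lift _ (half_map T) _ (half_symbol c d) k (z, true) (z', false) zz'.
by exists y.
Qed.

Variables (A B : finType) (s : Z -> A) (t : Z -> B).
Variables (phi : A -> C * D) (psi : B -> D * C).
Hypotheses (phiI : injective phi) (psiI : injective psi).
Hypothesis phiE : forall z, phi (s z) = (c z, d z).
Hypothesis psiE : forall z, psi (t z) = (d z, c (T z)).

(** Every [z] gives an edge of P labeled [c z] from the past of (z, false) to that of (z, true), and
    an edge of Q labeled [d z] from there to the past of (T z, false). All identities become
    instances of those for indicator matrices. *)
Lemma bipartite_gsse (G : finGroupType) (S : symbolic_system A)
    (S' : symbolic_system B) (ell : A -> G) (ell' : B -> G) (ellC : C -> G)
    (ellD : D -> G) :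
  canonical_presentation T s S -> canonical_presentation T t S' ->
  (forall a, ell a = (ellC (phi a).1 * ellD (phi a).2)%g) ->
  (forall b, ell' b = (ellD (psi b).1 * ellC (psi b).2)%g) ->
  proper_gsse1 (GroupSystem S ell) (GroupSystem S' ell').
Proof.
move=> [q [qP qM qI]] [q' [q'P q'M q'I]] ellE ellE'.
(* At even half-levels the half-pasts are the pasts of [s], so the numberings of [S] can be used
   there. *)
have [n [p [nm [pq pP]]]] : exists (n : nat -> nat) (p : forall k, Z -> 'I_(n k))
    (nm : forall l, n l.*2 = dim S l),
    (forall l, cast_ord (nm l) \o p l.*2 = q l) /\
    (forall k, quotient_map (past k false) (p k)).
  apply: (@level_family _ _ (fun k => past k false)); last first.
    by move=> k; exact: quotient_map_exists.
  move=> l; have [qs qE] := qP l; split=> // z z'.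
  by rewrite qE (half_past_even T_surj phiI phiE).
have [n' [p' [nm' [pq' pP']]]] : exists (n : nat -> nat)
    (p : forall k, Z -> 'I_(n k)) (nm : forall l, n l.*2 = dim S' l),
    (forall l, cast_ord (nm l) \o p l.*2 = q' l) /\
    (forall k, quotient_map (past k true) (p k)).
  apply: (@level_family _ _ (fun k => past k true)); last first.
    by move=> k; exact: quotient_map_exists.
  move=> l; have [qs qE] := q'P l; split=> // z z'.
  by rewrite qE (half_past_even' T_surj psiI psiE).
have pE k z z' : p k z = p k z' <-> past k false z = past k false z' by exact: (pP k).2.
have pE' k z z' : p' k z = p' k z' <-> past k true z = past k true z' by exact: (pP' k).2.
have pS k z z' : p k.+1 z = p k.+1 z' -> p k z = p k z'.
  by move=> /pE zz'; apply/pE; exact: half_pastS.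
have pS' k z z' : p' k.+1 z = p' k.+1 z' -> p' k z = p' k z'.
  by move=> /pE' zz'; apply/pE'; exact: half_pastS.
have p_det k z z' : c z = c z' -> p' k.+1 z = p' k.+1 z' -> p k z = p k z'.
  by move=> cz /pE' zz'; apply/pE; exact: half_past_cons.
have p_det' k z z' : d z = d z' -> p k.+1 (T z) = p k.+1 (T z') -> p' k z = p' k z'.
  by move=> dz /pE zz'; apply/pE'; exact: half_past_cons'.
have p_lift k z z' : p' k.+1 z = p' k.+1 z' -> exists y,
    [/\ c y = c z, itin (y, true) = itin (z', true) & p k y = p k z].
  move=> /pE' zz'; have [y [cy yz' py]] := half_past_lift zz'.
  by exists y; split=> //; apply/pE.
have p_lift' k z z' : p k.+1 (T z) = p k.+1 z' -> exists y,
    [/\ d y = d z, itin (T y, false) = itin (z', false) & p' k y = p' k z].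
  move=> /pE zz'; have [y [dy yz' py]] := half_past_lift' zz'.
  by exists y; split=> //; apply/pE'.
pose P k := sym_mx (p k) c (p' k.+1).
pose Q k := sym_mx (p' k) d (p k.+1 \o T).
have MPQ l : map_mx (substitute phi) (Mx S l) =
    castmx (nm l, nm l.+1) (symbolic_mul (P l.*2) (Q l.*2.+1)).
  rewrite qM sym_mx_substitute //.
  (* Two edges meeting in the middle merge into one orbit: [p_lift] keeps the symbol and past of [z]
     and takes over the itinerary of (z', true). *)
  have -> : symbolic_mul (P l.*2) (Q l.*2.+1) =
      sym_mx (p l.*2) (fun z => (c z, d z)) (p l.*2.+2 \o T).
    apply: (@sym_mx_comp _ _ _ _ _ _ (p l.*2) (p' l.*2.+1) (p l.*2.+2) c d id T).
      by move=> z z'; exact: p_det'.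
    move=> z z' /p_lift[y [cy /half_itinerary_cons[dy yz'] py]]; exists y.
    by split=> //; apply/pE; exact: half_past_itinerary.
  rewrite sym_mx_cast -!pq; apply: sym_mx_ext => // z; exact: phiE.
have MQP l : map_mx (substitute psi) (Mx S' l) =
    castmx (nm' l, nm' l.+1) (symbolic_mul (Q l.*2) (P l.*2.+1)).
  rewrite q'M sym_mx_substitute //.
  have -> : symbolic_mul (Q l.*2) (P l.*2.+1) =
      sym_mx (p' l.*2) (fun z => (d z, c (T z))) (p' l.*2.+2 \o T).
    apply: (@sym_mx_comp _ _ _ _ _ _ (p' l.*2) (p l.*2.+1) (p' l.*2.+2) d c T id).
      by move=> z z'; exact: p_det.
    move=> z z' /p_lift'[y [dy /half_itinerary_cons'[cy yz'] py]]; exists y.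
    by split=> //; apply/pE'; exact: half_past_itinerary.
  rewrite sym_mx_cast -!pq'; apply: sym_mx_ext => // z; exact: psiE.
pose X k := inc_mx (p k) (p k.+1).
pose X' k := inc_mx (p' k) (p' k.+1).
have IX l : Ix S l = castmx (nm l, nm l.+1) (X l.*2 *m X l.*2.+1)%R.
  rewrite qI inc_mx_comp ?inc_mx_cast -?pq //; exact: pS.
have IX' l : Ix S' l = castmx (nm' l, nm' l.+1) (X' l.*2 *m X' l.*2.+1)%R.
  rewrite q'I inc_mx_comp ?inc_mx_cast -?pq' //; exact: pS'.
have XP k : symbolic_mull (X k) (P k.+1) = symbolic_mulr (P k) (X' k.+1).
  apply: (@sym_inc_comm _ _ _ _ _ _ (p k) (p k.+1) (p' k.+1) (p' k.+2) c id).
  - exact: pS.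
  - exact: pS'.
  - by move=> z z'; exact: p_det.
  - move=> z z' /p_lift[y [cy yz' py]]; exists y; split=> //.
    by apply/pE'; exact: half_past_itinerary.
have XQ k : symbolic_mull (X' k) (Q k.+1) = symbolic_mulr (Q k) (X k.+1).
  apply: (@sym_inc_comm _ _ _ _ _ _ (p' k) (p' k.+1) (p k.+1) (p k.+2) d T).
  - exact: pS'.
  - exact: pS.
  - by move=> z z'; exact: p_det'.
  - move=> z z' /p_lift'[y [dy yz' py]]; exists y; split=> //.
    by apply/pE; exact: half_past_itinerary.
have inc01 i j (f : Z -> 'I_i) (g : Z -> 'I_j) : zero_one (inc_mx f g).
  by move=> a b; rewrite mxE; case: asboolP; [right | left].
have mono k : (n k <= n k.+1)%N.
  by apply: quotient_map_leq (pP k) (pP k.+1) _ => z z'; exact: half_pastS.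
have mono' k : (n' k <= n' k.+1)%N.
  by apply: quotient_map_leq (pP' k) (pP' k.+1) _ => z z'; exact: half_pastS.
exact: (@proper_gsse1_of_sse G (GroupSystem S ell) (GroupSystem S' ell')
  (ProperSSE1 phiI psiI mono mono' (fun k => @inc01 _ _ _ _)
   (fun k => @inc01 _ _ _ _) MPQ MQP IX IX' XP XQ) ellC ellD).
Qed.

End BipartiteEquivalence.

(** * Chains of bipartite presentations *)

Section Linked.
Variables (G : finGroupType) (Z : Type) (T : Z -> Z).
Hypothesis T_surj : forall z, exists y, T y = z.

(** Quantifying over all canonical systems of both presentations makes the relation independent of
    numberings. *)
Definition linked (A B : finType) (s : Z -> A) (t : Z -> B) (ell : A -> G)
    (ell' : B -> G) : Prop := forall S S',
  canonical_presentation T s S -> canonical_presentation T t S' ->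
  proper_gsse (GroupSystem S ell) (GroupSystem S' ell').

Definition coarser (U V : Type) (u : Z -> U) (v : Z -> V) : Prop :=
  forall z z', v z = v z' -> u z = u z'.

Lemma linked_sym (A B : finType) (s : Z -> A) (t : Z -> B) ell ell' :
  linked s t ell ell' -> linked t s ell' ell.
Proof. by move=> st S S' tS sS'; apply: proper_gsse_sym; exact: st. Qed.

Lemma linked_trans (A B C : finType) (s : Z -> A) (t : Z -> B) (r : Z -> C)
    ell ell' ell'' :
  linked s t ell ell' -> linked t r ell' ell'' -> linked s r ell ell''.
Proof.
move=> st tr S R sS rR.
have [S' tS'] := canonical_presentation_exists T_surj t.
exact: t_trans (st _ _ sS tS') (tr _ _ tS' rR).
Qed.

Lemma linked_bipartite (A B C D : finType) (c : Z -> C) (d : Z -> D)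
    (s : Z -> A) (t : Z -> B) (phi : A -> C * D) (psi : B -> D * C) ell ell'
    (ellC : C -> G) (ellD : D -> G) :
  injective phi -> injective psi ->
  (forall z, phi (s z) = (c z, d z)) -> (forall z, psi (t z) = (d z, c (T z))) ->
  (forall a, ell a = (ellC (phi a).1 * ellD (phi a).2)%g) ->
  (forall b, ell' b = (ellD (psi b).1 * ellC (psi b).2)%g) ->
  linked s t ell ell'.
Proof.
move=> phiI psiI phiE psiE ellE ellE' S S' sS tS'; apply: t_step.
exact: (bipartite_gsse T_surj phiI psiI phiE psiE sS tS' ellE ellE').
Qed.

(** [v0] is the value at symbols that [s] never takes. *)
Lemma factor_exists (A : finType) (V : Type) (v0 : V) (s : Z -> A) (f : Z -> V) :
  coarser f s -> exists h : A -> V, forall z, h (s z) = f z.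
Proof.
move=> fs; have ex a : exists v, forall z, s z = a -> v = f z.
  have [[z <-]|nz] := pselect (exists z, s z = a).
    by exists (f z) => z' /fs.
  by exists v0 => z za; case: nz; exists z.
have [h hP] := choice ex.
by exists h => z; exact: hP.
Qed.

(* The symbols outside the image of [t] are sent to a disjoint copy, so that
   the specification is injective on the whole alphabet. *)
Lemma linked_shift (A B : finType) (s : Z -> A) (t : Z -> B) ell ell' :
  (forall z z', t z = t z' <-> s (T z) = s (T z')) ->
  (forall z, ell' (t z) = ell (s (T z))) -> linked s t ell ell'.
Proof.
move=> ts ellE.
have ex b : exists v : A + B, (forall z, t z = b -> v = inl (s (T z))) /\
    ((~ exists z, t z = b) -> v = inr b).
  have [[z <-]|nz] := pselect (exists z, t z = b).
    by exists (inl (s (T z))); split=> [z' /ts->|[]] //; exists z.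
  by exists (inr b); split=> // z zb; case: nz; exists z.
have [h hP] := choice ex.
have hI : injective h.
  move=> b b'.
  have [[z <-]|nz] := pselect (exists z, t z = b);
    have [[z' <-]|nz'] := pselect (exists z, t z = b').
  - by rewrite ((hP _).1 z erefl) ((hP _).1 z' erefl) => -[/ts].
  - by rewrite ((hP _).1 z erefl) ((hP _).2 nz').
  - by rewrite ((hP _).2 nz) ((hP _).1 z' erefl).
  - by rewrite ((hP _).2 nz) ((hP _).2 nz') => -[].
(* With a one-point [D], the pair (c, d) reads [s] now and (d, c T) reads [s] one step later. *)
apply: (@linked_bipartite _ _ _ _ (fun z => inl (s z)) (fun=> tt) _ _
  (fun a => (inl a, tt)) (fun b => (tt, h b)) _ _
  (fun v => match v with inl a => ell a | inr b => ell' b end) (fun=> 1%g)).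
- by move=> a a' [].
- by move=> b b' [/hI].
- by [].
- by move=> z; rewrite ((hP _).1 z erefl).
- by move=> a; rewrite mulg1.
- move=> b /=; rewrite mul1g.
  have [[z <-]|nz] := pselect (exists z, t z = b).
    by rewrite ((hP _).1 z erefl) ellE.
  by rewrite ((hP _).2 nz).
Qed.

(** A step with trivial [D] always advances time by one, so both presentations are compared with
    [s \o T]. *)
Lemma linked_equiv (A B : finType) (s : Z -> A) (t : Z -> B) ell ell' :
  (forall z z', t z = t z' <-> s z = s z') ->
  (forall z, ell' (t z) = ell (s z)) -> linked s t ell ell'.
Proof.
move=> ts ellE; apply: (@linked_trans _ _ _ _ (s \o T) _ _ ell).
  exact: linked_shift.
apply: linked_sym; apply: linked_shift => [z z'|z] /=; last by rewrite ellE.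
by split=> /ts.
Qed.

Lemma linked_iter (A B : finType) (s : Z -> A) (t : Z -> B) ell ell' j :
  (forall z z', t z = t z' <-> s (iter j T z) = s (iter j T z')) ->
  (forall z, ell' (t z) = ell (s (iter j T z))) -> linked s t ell ell'.
Proof.
elim: j s => [|j IH] s ts ellE; first exact: linked_equiv.
apply: (@linked_trans _ _ _ _ (s \o T) _ _ ell); first exact: linked_shift.
exact: IH.
Qed.

(** Split [s] as (u, s); the swapped pair (s, u T) extends the window to the right. Giving [u] the
    weight gamma and [s] the rest twists the weight by the coboundary. *)
Lemma linked_right (A B U : finType) (s : Z -> A) (t : Z -> B) (u : Z -> U)
    (gamma : Z -> G) ell ell' :
  coarser u s -> coarser gamma u ->
  (forall z z', t z = t z' <-> s z = s z' /\ u (T z) = u (T z')) ->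
  (forall z, ell' (t z) = ((gamma z)^-1 * ell (s z) * gamma (T z))%g) ->
  linked s t ell ell'.
Proof.
move=> us gu tE ellE.
(* [None] is a default value available even when [U] is empty. *)
have [h hE] : exists h : A -> option U, forall z, h (s z) = Some (u z).
  by apply: (factor_exists None) => z z' /us->.
have [g gE] : exists g : option U -> G, forall z, g (Some (u z)) = gamma z.
  by apply: (@factor_exists _ _ 1%g (Some \o u)) => z z' [/gu].
pose ell0 (b : A * option U) := ((g (h b.1))^-1 * ell b.1 * g b.2)%g.
apply: (@linked_trans _ _ _ _ (fun z => (s z, Some (u (T z)))) _ _ ell0).
  apply: (@linked_bipartite _ _ _ _ (Some \o u) s _ _ (fun a => (h a, a)) id _ _
    g (fun a => (g (h a))^-1 * ell a)%g) => //.
  - by move=> a a' [].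
  - by move=> z; rewrite hE.
  - by move=> a; rewrite mulKVg.
apply: linked_equiv => [z z'|z]; last by rewrite ellE /ell0 /= hE !gE.
by rewrite tE; split=> [[-> ->]|[-> ->]].
Qed.

(** Now [s] is split as (s, u), so the swapped pair (u, s T) keeps [u] at the old time and extends
    the window to the left; the weight moves with [s]. *)
Lemma linked_left (A B U : finType) (s : Z -> A) (t : Z -> B) (u : Z -> U) ell ell' :
  coarser u s ->
  (forall z z', t z = t z' <-> u z = u z' /\ s (T z) = s (T z')) ->
  (forall z, ell' (t z) = ell (s (T z))) ->
  linked s t ell ell'.
Proof.
move=> us tE ellE.
have [h hE] : exists h : A -> option U, forall z, h (s z) = Some (u z).
  by apply: (factor_exists None) => z z' /us->.
apply: (@linked_trans _ _ _ _ (fun z => (Some (u z), s (T z))) _ _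
  (fun b => ell b.2)).
  apply: (@linked_bipartite _ _ _ _ s (Some \o u) _ _ (fun a => (a, h a)) id _ _
    ell (fun=> 1%g)) => //.
  - by move=> a a' [].
  - by move=> z; rewrite hE.
  - by move=> a; rewrite mulg1.
  - by move=> b; rewrite mul1g.
apply: linked_equiv => [z z'|z]; last by rewrite ellE.
by rewrite tE; split=> [[-> ->]|[-> ->]].
Qed.

Definition same_window (U : Type) (u : Z -> U) n z z' : Prop :=
  forall i, (i < n)%N -> u (iter i T z) = u (iter i T z').

(** The window grows [m] times to the left, each time advancing [s] by one, then [n] times to the
    right with trivial transfer function. *)
Lemma linked_window (A U : finType) (s : Z -> A) (u : Z -> U) ell m n :
  coarser u s -> exists (B : finType) (t : Z -> B) (ell' : B -> G),
    [/\ linked s t ell ell',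
        forall z z', t z = t z' <->
          s (iter m T z) = s (iter m T z') /\ same_window u (m + n).+1 z z' &
        forall z, ell' (t z) = ell (s (iter m T z))].
Proof.
move=> us; elim: n => [|n [B [t [ell' [st tE ellE]]]]]; last first.
  exists (B * U)%type, (fun z => (t z, u (iter (m + n).+1 T z))), (fun b => ell' b.1).
  split=> // [|z z'].
    apply: linked_trans st _.
    (* The last symbol of the current window is a function of [t]; its successor is the symbol
       appended. *)
    apply: (@linked_right _ _ _ _ _ (u \o iter (m + n) T) (fun=> 1%g)) => //.
    - by move=> z z' /tE[_ w]; exact: w.
    - by move=> z z'; rewrite /= -!iterSr; split=> [[-> ->]|[-> ->]].
    - by move=> z; rewrite invg1 mul1g mulg1.
  rewrite addnS; split=> [[/tE[-> w] uE]|[sE w]].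
    by split=> // i; rewrite ltnS leq_eqVlt => /predU1P[->|/w].
  apply: pair_eq; last exact: w.
  by apply/tE; split=> // i lt; apply: w; exact: ltnW.
rewrite addn0; elim: m => [|m [B [t [ell' [st tE ellE]]]]].
  exists A, s, ell; split=> // [|z z']; first exact: linked_equiv.
  split=> [sE|[]] //; split=> // i; rewrite ltnS leqn0 => /eqP->.
  exact: us.
exists (U * B)%type, (fun z => (u z, t (T z))), (fun b => ell' b.2).
split=> [|z z'|z]; last by rewrite /= ellE -iterSr.
  apply: linked_trans st _; apply: (@linked_left _ _ _ _ _ u) => //.
    by move=> z z' /tE[_ w]; exact: (w 0%N).
  by move=> z z'; split=> [[-> ->]|[-> ->]].
rewrite !iterSr; split=> [[uE /tE[-> w]]|[sE w]].
  by split=> // -[|i] //; rewrite ltnS !iterSr; exact: w.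
apply: pair_eq; first exact: (w 0%N).
by apply/tE; split=> // i lt; rewrite -!iterSr; exact: w.
Qed.

Lemma linked_conjugate (A B : finType) (s : Z -> A) (t : Z -> B) (gamma : Z -> G)
    (ell : A -> G) (ell' : B -> G) k m :
  (forall z, ell (s z) = (gamma z * ell' (t z) * (gamma (T z))^-1)%g) ->
  (forall z z', same_window s k.*2.+1 z z' ->
    t (iter k T z) = t (iter k T z') /\ gamma (iter k T z) = gamma (iter k T z')) ->
  (forall z z', same_window t m.*2.+1 z z' -> s (iter m T z) = s (iter m T z')) ->
  linked s t ell ell'.
Proof.
move=> ellE tgs st.
have self (V : Type) (v : Z -> V) : coarser v v by [].
have [B1 [b1 [ell1 [l1 b1E w1]]]] := linked_window ell k k (self _ s).
have b1s z z' : b1 z = b1 z' -> same_window s k.*2.+1 z z'.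
  by move=> /b1E[_]; rewrite addnn.
pose b2 z := (b1 z, b1 (T z)).
have tb2 : coarser (t \o iter k T) b2.
  by move=> z z' [/b1s/tgs[tE _] _].
have [ell2 w2] : exists h : B1 * B1 -> G, forall z, h (b2 z) = ell' (t (iter k T z)).
  by apply: (factor_exists 1%g) => z z' /tb2 /= ->.
have l2 : linked b1 b2 ell1 ell2.
  (* The weight is read at time [k], the center of the window of [s] that determines gamma there;
     twisting turns it into the weight of [t] at time [k]. *)
  apply: (@linked_right _ _ _ _ _ b1 (gamma \o iter k T)) => //.
  - by move=> z z' /b1s/tgs[_].
  - by move=> z z'; split=> [[]|[b1z b1Tz]] //; exact: pair_eq.
  - move=> z; rewrite w1 w2 ellE /= -iterSr iterS.
    by rewrite !mulgA mulVg mul1g mulgKV.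
(* Recovering [s] at the times M, ..., M+2k+1 takes [t] from M-m = k up to M+2k+1+m = k+M+n, so that
   window of [t] determines all of [b3]. *)
pose M := (m + k)%N; pose n := (k + m).+1.
have [B3 [b3 [ell3 [l3 b3E w3]]]] := linked_window ell2 M n tb2.
have [B4 [b4 [ell4 [l4 b4E w4]]]] := linked_window ell' M n (self _ t).
apply: linked_trans l1 (linked_trans l2 (linked_trans l3 _)).
apply: linked_sym; apply: linked_trans l4 _.
(* Hence [b3] is, up to naming, the window [b4] of [t] read [k] steps later. *)
apply: (@linked_iter _ _ _ _ _ _ k) => [z z'|z]; last first.
  by rewrite w3 w2 w4 -!iterD addnC.
have b3w : b3 z = b3 z' <-> same_window t (M + n).+1 (iter k T z) (iter k T z').
  rewrite b3E; split=> [[_ w] i /w|w]; first by rewrite /= -!iterD addnC.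
  split; last by move=> i /w; rewrite /= -!iterD addnC.
  have sw i : (i < k.*2.+2)%N -> s (iter (M + i) T z) = s (iter (M + i) T z').
    move=> ik; rewrite -addnA !(iterD m); apply: st => j jm.
    rewrite -!iterD; have -> : (j + (k + i) = (i + j) + k)%N by lia.
    by rewrite !(iterD (i + j)); apply: w; rewrite /M /n; lia.
  have b1w r : (r <= 1)%N -> b1 (iter (r + M) T z) = b1 (iter (r + M) T z').
    move=> r1; apply/b1E; rewrite addnn; split.
      rewrite -!iterD (_ : (k + (r + M) = M + (k + r))%N); last by lia.
      by apply: sw; lia.
    move=> i ik; rewrite -!iterD (_ : (i + (r + M) = M + (i + r))%N); last by lia.
    by apply: sw; lia.
  by apply: pair_eq; [exact: (b1w 0%N) | exact: (b1w 1%N)].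
rewrite b3w b4E; split=> [w|[_ w]] //; split=> //.
by apply: w; rewrite /M; lia.
Qed.

End Linked.

(** * Canonical lambda-graph systems as canonical presentations *)

Section PastWords.
Variables (Z : Type) (T : Z -> Z) (A : finType) (s : Z -> A).
Variable X : set (full_shift A).
Hypothesis T_surj : forall z, exists y, T y = z.
Hypothesis right_itinerary : forall r,
  right_points X r <-> exists z, itinerary T s z = r.

Lemma iter_surj n z : exists y, iter n T y = z.
Proof.
elim: n z => [|n IH] z; first by exists z.
by have [y <-] := T_surj z; have [x <-] := IH y; exists x.
Qed.

Lemma prepend_rcons v a (r : nat -> A) :
  prepend (rcons v a) r = prepend v (prepend [:: a] r).
Proof.
apply/funext => k; rewrite /prepend size_rcons nth_rcons /=.
case: ltnP => vk; first exact: set_nth_default.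
rewrite [RHS]nth_default // eqn_leq vk andbT -subn_eq0.
by case E: (k - size v)%N => [|m] //=; rewrite nth_nil; congr r; lia.
Qed.

Lemma itinerary_prepend w r y : itinerary T s y = prepend w r ->
  itinerary T s (iter (size w) T y) = r.
Proof.
move=> yw; apply/funext => k; have := congr1 (fun f => f (k + size w)%N) yw.
by rewrite /itinerary /prepend iterD nth_default ?leq_addl // addnK.
Qed.

Lemma itinerary_prepend1 a r y : itinerary T s y = prepend [:: a] r <->
  s y = a /\ itinerary T s (T y) = r.
Proof.
split=> [yr|[<- <-]].
  by split; [exact: (congr1 (fun f => f 0%N) yr) | exact: itinerary_prepend yr].
by apply/funext => -[|k]; rewrite /prepend /itinerary //= nth_nil subn1 -iterSr.
Qed.

Lemma itinerary_word l y :
  itinerary T s y = prepend [tuple s (iter k T y) | k < l] (itinerary T s (iter l T y)).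
Proof.
apply/funext => k; rewrite /prepend /itinerary size_tuple.
have [kl|lk] := ltnP k l; last first.
  by rewrite nth_default ?size_tuple // -iterD subnK.
by rewrite -[k]/(nat_of_ord (Ordinal kl)) -tnth_nth tnth_mktuple.
Qed.

Lemma pastP l r (w : l.-tuple A) :
  past X l r w <-> exists y, itinerary T s y = prepend w r.
Proof.
rewrite -right_itinerary; split=> [[]|Rw] //; split=> //.
(* Right parts start at coordinate 1, where [w] is found. *)
have [x Xx xw] := Rw; exists x; split=> //; exists 1%R.
apply: eq_from_tnth => k; rewrite tnth_mktuple.
have := congr1 (fun f => f (k : nat)) xw; rewrite /right_part /prepend => E.
rewrite -add1n PoszD in E; rewrite E; exact/esym/tnth_nth.
Qed.

Lemma past_rcons l r (v : l.-tuple A) a :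
  past X l.+1 r [tuple of rcons v a] <-> past X l (prepend [:: a] r) v.
Proof. by rewrite !pastP /= prepend_rcons. Qed.

Lemma tuple_rcons l (w : l.+1.-tuple A) :
  exists (v : l.-tuple A) a, w = [tuple of rcons v a].
Proof.
case: w => w; case/lastP: w => [//|v a] sz.
have sv : size v == l by rewrite size_rcons in sz.
by exists (Tuple sv), a; apply: val_inj.
Qed.

(** The induction peels off the letter of a past word adjacent to the sequence: what precedes it is
    a past word, one shorter, of the prepended sequence. *)
Lemma past_code_past l z z' : past_code T s l z = past_code T s l z' <->
  past X l (itinerary T s z) = past X l (itinerary T s z').
Proof.
elim: l z z' => [|l IH] z z'.
  split=> // _; apply/funext => w; apply/propext; rewrite !pastP tuple0.
  by split=> _; [exists z' | exists z]; apply/funext => k;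
    rewrite /prepend nth_nil subn0.
have sim u u' : past_sim T s (past_code T s l) u u' ->
    (past X l.+1 (itinerary T s u) `<=` past X l.+1 (itinerary T s u'))%classic.
  move=> uu' w; have [v [a ->]] := tuple_rcons w.
  move=> /past_rcons /pastP[y0 y0E]; have yE := itinerary_prepend y0E.
  have [sy yu] := (itinerary_prepend1 _ _ _).1 yE.
  have [y' [sy' y'u' /IH cy]] := uu' _ yu.
  have y'E := (itinerary_prepend1 _ _ _).2 (conj (etrans sy' sy) y'u').
  by apply/past_rcons; rewrite -y'E cy yE; apply/pastP; exists y0.
have sim' u u' : past X l.+1 (itinerary T s u) = past X l.+1 (itinerary T s u') ->
    past_sim T s (past_code T s l) u u'.
  (* One past word of [y] suffices to exhibit a predecessor over [u'] with the symbol [s y];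
     equality of all its past words with those of [y] then comes from [uu']. *)
  move=> uu' y yu; have [y0 y0y] := iter_surj l y.
  have yE := (itinerary_prepend1 _ _ _).2 (conj erefl yu).
  have : past X l.+1 (itinerary T s u)
      [tuple of rcons [tuple s (iter k T y0) | k < l] (s y)].
    apply/past_rcons/pastP; exists y0.
    by rewrite {1}(itinerary_word l y0) y0y yE.
  rewrite uu' => /past_rcons/pastP[y1 /itinerary_prepend y1E].
  have [sy' y'u'] := (itinerary_prepend1 _ _ _).1 y1E.
  exists (iter (size [tuple s (iter k T y0) | k < l]) T y1); split=> //.
  apply/IH/funext => v; apply/propext.
  by rewrite y1E yE -!past_rcons uu'.
split=> [/past_codeP[zz' z'z]|zz']; first by apply/seteqP; split; apply: sim.
by apply/past_codeP; split; apply: sim'.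
Qed.

(** The numbering sends [z] to the vertex whose class contains the itinerary of [z]; edges and
    [iota] are then compared class by class. *)
Lemma canonical_presentationP (L : lambda_graph A) (S : symbolic_system A) :
  associated S L -> canonical_of L X -> canonical_presentation T s S.
Proof.
move=> [v [vbij vM vI]] [F [Finj Frange Fedge Fiota]].
have class l (u : vertex L l) : exists z, F l u = past_class X l (itinerary T s z).
  have : range (F l) (F l u) by exists u.
  by rewrite Frange => -[x /right_itinerary[z <-] <-]; exists z.
have ex l z : exists i, F l (v l i) = past_class X l (itinerary T s z).
  have [v' _ v'K] := vbij l.
  have : (past_class X l @` right_points X)%classic (past_class X l (itinerary T s z)).
    by exists (itinerary T s z) => //; apply/right_itinerary; exists z.
  by rewrite -Frange => -[u _ uE]; exists (v' u); rewrite v'K.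
pose q l := projT1 (choice (ex l)).
have qE l z : F l (v l (q l z)) = past_class X l (itinerary T s z).
  exact: (projT2 (choice (ex l))).
have classE l z z' : past_class X l (itinerary T s z) =
    past_class X l (itinerary T s z') <-> past_code T s l z = past_code T s l z'.
  rewrite past_code_past; split=> [zz'|zz']; last by rewrite /past_class zz'.
  have : past_class X l (itinerary T s z) (itinerary T s z).
    by split=> //; apply/right_itinerary; exists z.
  by rewrite zz' => -[].
have qC l z z' : q l z = q l z' <-> past_code T s l z = past_code T s l z'.
  rewrite -classE -!qE; split=> [->//|/Finj]; exact/bij_inj.
have FP l i r : F l (v l i) r <-> exists z, itinerary T s z = r /\ q l z = i.
  split=> [Fr|[z [<- <-]]]; last first.
    by rewrite qE; split=> //; apply/right_itinerary; exists z.
  have [z0 z0E] := class l (v l i); move: (Fr).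
  rewrite z0E => -[/right_itinerary[z zr] pz]; exists z; split=> //.
  apply: (bij_inj (vbij l)); apply: Finj; rewrite qE z0E.
  by rewrite /past_class zr pz.
have qS l i : exists z, q l z = i.
  have [z0 z0E] := class l (v l i); exists z0.
  by apply: (bij_inj (vbij l)); apply: Finj; rewrite qE z0E.
exists q; split=> l; first by split.
  apply/matrixP => i j; apply/ffunP => a; rewrite mxE ffunE vM sum_symbolE.
  (* Left-resolving allows at most one edge with given label and terminal, so the multiplicity is a
     truth value. *)
  set E := [set e | _]; transitivity ((0 < #|E|) : nat).
    have : (#|E| <= 1)%N.
      apply/card_le1_eqP => e f; rewrite !inE.
      move=> /andP[/andP[_ /eqP te] /eqP le] /andP[/andP[_ /eqP tf] /eqP lf].
      apply: contrapT => ef; case: (left_resolving ef); first by rewrite le lf.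
      by rewrite te tf.
    by case: #|E| => [|[]].
  congr nat_of_bool; apply/idP/asboolP => [|[z [zi za zj]]].
    rewrite card_gt0 => /set0Pn[e]; rewrite inE => /andP[/andP[/eqP se /eqP te] /eqP le].
    have [|x /FP[z' [<- z'j]] /FP[z [zE zi]]] := (Fedge l (v l i) (v l.+1 j) a).1.
      by exists e.
    have [sz zz'] := (itinerary_prepend1 _ _ _).1 zE; exists z; split=> //=.
    by rewrite -z'j; apply/qC; exact: itinerary_past.
  have [|e [se te le]] := (Fedge l (v l i) (v l.+1 j) a).2.
    exists (itinerary T s (T z)); first by apply/FP; exists (T z).
    by apply/FP; exists z; split=> //; apply/itinerary_prepend1.
  by rewrite card_gt0; apply/set0Pn; exists e; rewrite inE se te le !eqxx.
apply/matrixP => i j; rewrite mxE vI; congr nat_of_bool.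
apply/eqP/asboolP => [/Fiota ji|[z [zi zj]]].
  have [z zj] := qS l.+1 j; exists z; split=> //.
  have /ji/FP[z' [zz' <-]] : F l.+1 (v l.+1 j) (itinerary T s z).
    by apply/FP; exists z.
  by apply/qC; exact/esym/itinerary_past.
apply/Fiota => r /FP[z' [<- z'j]]; apply/FP; exists z'; split=> //.
by rewrite -zi; apply/qC/past_codeS/qC; rewrite z'j.
Qed.

End PastWords.

(** * Itineraries along a shift-commuting map *)

Section SubshiftItinerary.
Variables (Z : Type) (T : Z -> Z) (A : finType) (X : subshift A) (f : Z -> X).
Hypothesis f_shift : forall z, f (T z) = shift_on (f z).

Lemma iter_shift_on n (x : X) : iter n (@shift_on _ X) x = shiftz_on n x.
Proof.
elim: n => [|n IH]; first by rewrite shiftz_on0.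
by rewrite iterS IH -shiftz_on1 shiftz_onD.
Qed.

Lemma iter_equivariant n z : f (iter n T z) = shiftz_on n (f z).
Proof. by rewrite -iter_shift_on; elim: n => //= n <-. Qed.

Lemma subshift_itinerary z k :
  itinerary T (fun z => val (f z) 0%R) z k = val (f z) k%:Z%R.
Proof. by rewrite /itinerary iter_equivariant /= /shiftz add0r. Qed.

Lemma subshift_right_points : (forall x, exists z, f z = x) ->
  forall r, right_points X r <-> exists z, itinerary T (fun z => val (f z) 0%R) z = r.
Proof.
move=> f_surj r; split=> [[x Xx <-]|[z <-]].
  (* Itineraries start at coordinate 0 and right parts at 1, hence one shift here and its inverse
     below. *)
  have [z zx] := f_surj (shift_on (SigSub (mem_set Xx) : X)); exists z.
  apply/funext => k; rewrite subshift_itinerary zx /= /shift /right_part.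
  by congr x; lia.
exists (val (shiftz_on (-1) (f z))); first exact: set_mem (valP _).
apply/funext => k; rewrite subshift_itinerary /right_part /= /shiftz.
by congr (val (f z)); lia.
Qed.

(** A one-sided window of length [2k+1] is a centered window of radius [k] seen from time [k]. *)
Lemma window_agree k z z' :
  same_window T (fun z => val (f z) 0%R) k.*2.+1 z z' ->
  agree k (val (f (iter k T z))) (val (f (iter k T z'))).
Proof.
move=> w i ik; rewrite !iter_equivariant /= /shiftz.
have := w `|(i + k%:Z)%R|%N; rewrite !iter_equivariant /= /shiftz !add0r.
have -> : (`|(i + k%:Z)%R|%N : int) = (i + k%:Z)%R by lia.
by apply; lia.
Qed.

End SubshiftItinerary.

(** Through the conjugacy both subshifts are presented on the one space [presented L], by [s] and by
    [t]. *)
Lemma canonical_gsse (G : finGroupType) (Sigma Sigma' : finType)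
    (L : lambda_graph Sigma) (L' : lambda_graph Sigma')
    (S : symbolic_system Sigma) (S' : symbolic_system Sigma')
    (ell : Sigma -> G) (ell' : Sigma' -> G) :
  associated S L -> associated S' L' -> canonical_system L -> canonical_system L' ->
  weight_conjugate (presented L) (presented L') ell ell' ->
  proper_gsse (GroupSystem S ell) (GroupSystem S' ell').
Proof.
move=> SL SL' canL canL' [f [[[cf [f' [fK f'K cf']]] fs] [u [cu ue]]]].
pose T := @shift_on _ (presented L).
have T_surj z : exists y, T y = z.
  by exists (shiftz_on (-1) z); rewrite /T -shiftz_on1 shiftz_onD subrr shiftz_on0.
(* The finite memories of the conjugacy, the transfer function and the inverse conjugacy. *)
have [k1 k1P] := local_uniform ((continuous_subshift f).1 cf 0%R).
have [k2 k2P] := local_uniform ((continuous_local u).1 cu).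
have [m mP] := local_uniform ((continuous_subshift f').1 cf' 0%R).
pose s (z : presented L) := val z 0%R; pose t (z : presented L) := val (f z) 0%R.
have st : linked T s t ell ell'.
  apply: (@linked_conjugate _ _ _ T_surj _ _ _ _ u _ _ (maxn k1 k2) m).
  - by move=> z; have := ue z.
  - move=> z z' /(window_agree (f := id) (fun=> erefl)) w.
    split; [apply: k1P | apply: k2P]; apply: agree_leq w.
      exact: leq_maxl.
    exact: leq_maxr.
  - by move=> z z' /(window_agree (f := f) fs)/mP; rewrite !fK.
apply: st.
  apply: (canonical_presentationP T_surj _ SL canL).
  by apply: (subshift_right_points (f := id)) => // x; exists x.
apply: (canonical_presentationP T_surj _ SL' canL').
by apply: (subshift_right_points (f := f)) => // x; exists (f' x).
Qed.

Theorem theorem1p3 (G : finGroupType) (Sigma Sigma' : finType)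
    (L : lambda_graph Sigma) (L' : lambda_graph Sigma')
    (S : symbolic_system Sigma) (S' : symbolic_system Sigma')
    (SL : associated S L) (SL' : associated S' L')
    (ell : Sigma -> G) (ell' : Sigma' -> G) :
  let cond1 := proper_gsse (GroupSystem S ell) (GroupSystem S' ell') in
  let cond2 := exists Phi : presented L -> presented L',
    conjugacy Phi /\
    cohomologous (tau (X := presented L) ell)
      (tau (X := presented L') ell' \o Phi) in
  let cond3 :=
    gconjugate (extension_gsubshift L ell) (extension_gsubshift L' ell') in
  (cond1 -> cond2) /\ (cond2 <-> cond3) /\
  (canonical_system L -> canonical_system L' -> cond2 -> cond1).
Proof.
split; last split; last 1 first.
- move=> canL canL'; exact: canonical_gsse.
- move=> /gsse_weight_conjugate /=.
  by rewrite -(associated_subshift SL) -(associated_subshift SL').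
- by split; [exact: weight_gconjugate | exact: gconjugate_weight].
Qed.
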